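(* Let $A$ be a subgroup of a group $G$ (not necessarily finite), and let $W$ be a subgroup of a finitely generated group $F$. Then a) each of the cardinals $|\mathrm{Hom}(F,W;G,A)|$, $|\mathrm{Epi}(F,W;G,A)|$, and $|\mathrm{Mono}(F,W;G,A)|$ is divisible by $\mathrm{GCD}\bigl(N(A),\exp(F/(F'W))\bigr)$; b) $|\mathrm{Hom}(F,W;G,A)|$ is divisible by $\mathrm{GCD}\bigl(A,\exp(F/F')\bigr)$; c) $|\mathrm{Epi}(F,W;G,A)|$ is divisible by $\mathrm{GCD}\bigl(A'A^{\exp(F/F')},\exp(F/F')\bigr)$; d) $|\mathrm{Mono}(F,W;G,A)|$ is divisible by $\mathrm{GCD}\bigl(A,\exp(F/(F'Z(W)))\bigr)$.
   Context: Sets of homomorphisms: for groups $F\supseteq W$ and $G\supseteq A$, $\mathrm{Hom}(F,W;G,A)$ is the set of all homomorphisms $\varphi:F\to G$ with $\varphi(W)\subseteq A$; $\mathrm{Epi}(F,W;G,A)$ is the set of all homomorphisms $\varphi:F\to G$ with $\varphi(W)=A$; $\mathrm{Mono}(F,W;G,A)$ is the set of all homomorphisms $\varphi:F\to G$ such that $\varphi(W)\subseteq A$ and the restriction of $\varphi$ to $W$ is injective. Notation: $N(A)$ is the normaliser of $A$ in $G$; $X'=[X,X]$ is the commutator subgroup of a group $X$; $Z(X)$ is the centre of $X$; for an integer $m$, $X^m$ is the subgroup of $X$ generated by $\{x^m \mid x\in X\}$. $\exp(X)$ is the period (exponent) of $X$ if it is finite, and $\exp(X)=0$ if the period is infinite.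 Divisibility is understood in the sense of cardinal arithmetic: an infinite cardinal is divisible by every nonzero cardinal not exceeding it; zero is divisible by all cardinals and divides only zero. For a group $X$ and an integer $m$, $\mathrm{GCD}(X,m)$ is the least common multiple of the orders of all subgroups $H$ of $X$ such that $|H|$ divides $m$; in particular $\mathrm{GCD}(X,0)=|X|$, and $\mathrm{GCD}(X,m)=\gcd(|X|,m)$ when $X$ is finite. *)

(* Defs.v *)
From HB Require Import structures.
From mathcomp Require Import all_boot generic_quotient.
From mathcomp Require Import all_classical.

Set Implicit Arguments.
Unset Strict Implicit.
Unset Printing Implicit Defensive.

Local Open Scope classical_set_scope.
Local Open Scope card_scope.
Local Open Scope group_scope.
Local Open Scope quotient_scope.

(* Cardinals are represented by sets, up to the relation [#=]. *)

(* Divisibility in cardinal arithmetic: |B| = |A| * |C| for some cardinal |C|. *)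
Definition card_dvd (T U : Type) (A : set T) (B : set U) : Prop :=
  exists (V : Type) (C : set V), B #= A `*` C.

Definition common_multiple (T U : Type) (Hs : set (set T)) (D : set U) : Prop :=
  forall H, Hs H -> card_dvd H D.

(* As for natural numbers, the least common multiple is the least nonzero one:
   zero is divisible by every cardinal. *)
Definition is_lcm (T U : Type) (Hs : set (set T)) (D : set U) : Prop :=
  [/\ D !=set0, common_multiple Hs D &
      forall (V : Type) (E : set V),
        E !=set0 -> common_multiple Hs E -> D #<= E].

Section Subgroups.
Variable G : groupType.
Implicit Types (A X : set G).

Definition subgroup A : Prop := group_closed [in A].

Definition normal_subgroup A : Prop :=
  subgroup A /\ forall x g : G, A x -> A (x ^ g).

Definition generated X : set G := smallest subgroup X.

Definition finitely_generated : Prop :=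
  exists2 S : set G, finite_set S & generated S = [set: G].

Definition mulset A X : set G := [set x * y | x in A & y in X].

(* Equality is needed here: for infinite A, the inclusion of A ^ g in A
   does not make g normalise A. *)
Definition normaliser A : set G := [set g | [set x ^ g | x in A] = A].

Definition derived X : set G := generated [set [~ x, y] | x in X & y in X].

Definition center X : set G := [set z | X z /\ forall x, X x -> commute z x].

Definition power_subgroup X (m : nat) : set G :=
  generated [set x ^+ m | x in X].

(* |D| = GCD(X, m) *)
Definition is_GCD (U : Type) X (m : nat) (D : set U) : Prop :=
  is_lcm [set H | [/\ subgroup H, H `<=` X & card_dvd H `I_m]] D.

Definition GCD_dvd (V : Type) X (m : nat) (B : set V) : Prop :=
  exists (U : Type) (D : set U), is_GCD X m D /\ card_dvd D B.

(* GCD(X, m) is well defined as a cardinal. *)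
Lemma is_GCD_unique (U V : Type) X m (D : set U) (E : set V) :
  is_GCD X m D -> is_GCD X m E -> D #= E.
Proof.
move=> [D0 cD lD] [E0 cE lE].
by rewrite card_eq_le (lD _ _ E0 cE) (lE _ _ D0 cD).
Qed.

Lemma subgroupP A :
  subgroup A <-> A 1 /\ forall x y, A x -> A y -> A (x / y).
Proof.
split=> [[/set_mem A1 AB]|[A1 AB]].
  by split=> // x y Ax Ay; apply/set_mem/AB; apply/mem_set.
split; first exact/mem_set.
by move=> x y /set_mem Ax /set_mem Ay; apply/mem_set/AB.
Qed.

Lemma subgroup1 A : subgroup A -> A 1.
Proof. by case/subgroupP. Qed.

Lemma subgroupV A x : subgroup A -> A x -> A x^-1.
Proof. by case/subgroupP=> A1 AB Ax; rewrite -[x^-1]mul1g; apply: AB. Qed.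

Lemma subgroupM A x y : subgroup A -> A x -> A y -> A (x * y).
Proof.
move=> sA Ax Ay; rewrite -[y]invgK.
by case/subgroupP: (sA) => _; apply=> //; apply: subgroupV.
Qed.

Lemma subgroup_generated X : subgroup (generated X).
Proof.
apply/subgroupP; split=> [B [sB _]|x y gx gy B [sB XB]]; first exact: subgroup1.
by case/subgroupP: (sB) => _; apply; [apply: gx | apply: gy].
Qed.

Lemma subgroup_center X : subgroup X -> subgroup (center X).
Proof.
move=> sX; apply/subgroupP; split.
  by split=> [|x _]; [exact: subgroup1 | exact/commute_sym/commute1].
move=> x y [Xx cx] [Xy cy]; split.
  by apply: subgroupM => //; apply: subgroupV.
move=> z Xz; apply/commute_sym/commuteM; first exact/commute_sym/cx.
exact/commuteV/commute_sym/cy.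
Qed.

Lemma derivedT_comm x y : derived [set: G] [~ x, y].
Proof. by apply: sub_gen_smallest; exists x => //; exists y. Qed.

Lemma normal_over_derived A :
  subgroup A -> derived [set: G] `<=` A -> normal_subgroup A.
Proof.
move=> sA dA; split=> // x g Ax.
have -> : x ^ g = x * [~ x, g] by rewrite commgEl mulgA mulgV mul1g.
by apply: (subgroupM sA Ax); apply: dA; apply: derivedT_comm.
Qed.

Lemma normal_derived : normal_subgroup (derived [set: G]).
Proof. by apply: normal_over_derived => //; exact: subgroup_generated. Qed.

Lemma normal_derivedM A :
  subgroup A -> normal_subgroup (mulset (derived [set: G]) A).
Proof.
move=> sA; have [sD nD] := normal_derived.
apply: normal_over_derived; last first.
  by move=> x Dx; exists x => //; exists 1; rewrite ?mulg1 //; apply: subgroup1 sA.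
apply/subgroupP; split.
  exists 1; first exact: subgroup1 sD.
  by exists 1; rewrite ?mulg1 //; apply: subgroup1 sA.
move=> _ _ [d Dd [a Aa <-]] [e De [b Ab <-]].
exists (d * (e^-1 ^ (a * b^-1)^-1)).
  by apply: (subgroupM sD Dd); apply: nD; apply: subgroupV sD _.
exists (a * b^-1); first by apply: (subgroupM sA Aa); apply: subgroupV sA _.
have cancel_c c : d * (e^-1 ^ c^-1) * c = d * c * e^-1.
  by rewrite conjgE invgK !mulgA mulgVK.
by rewrite cancel_c invgM !mulgA.
Qed.

End Subgroups.

Arguments finitely_generated : clear implicits.
Arguments normal_derived : clear implicits.

(* The period of X, with value 0 if it is infinite. *)
Definition exponent (X : groupType) : nat :=
  xget 0 [set n | [/\ (0 < n)%N, forall x : X, x ^+ n = 1 &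
    forall k, (0 < k)%N -> (forall x : X, x ^+ k = 1) -> (n <= k)%N]].

Section Quotient.
Variables (F : groupType) (N : set F) (nN : normal_subgroup N).

Definition coset_rel (x y : F) : bool := x^-1 * y \in N.

Lemma coset_relP x y : reflect (N (x^-1 * y)) (coset_rel x y).
Proof. by apply: (iffP idP) => [/set_mem|/mem_set]. Qed.

Let sN : subgroup N := nN.1.

Lemma coset_rel_equiv : equiv_class_of coset_rel.
Proof.
split=> [x|x y|y x z].
- by apply/coset_relP; rewrite mulVg; apply: subgroup1.
- by apply/coset_relP/coset_relP => /(subgroupV sN); rewrite invgM invgK.
- move=> /coset_relP Nxy /coset_relP Nyz; apply/coset_relP.
  by have := subgroupM sN Nxy Nyz; rewrite mulgA mulgK.
Qed.

Canonical coset_equiv : equiv_rel F := EquivRelPack coset_rel_equiv.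

Definition quotient : Type := {eq_quot coset_equiv}.
HB.instance Definition _ := Choice.on quotient.
HB.instance Definition _ := EqQuotient.on quotient.

Lemma coset_eqP (x y : F) :
  reflect (N (x^-1 * y)) (\pi_quotient x == \pi_quotient y).
Proof. by rewrite eqmodE; apply: coset_relP. Qed.

Definition quo_one : quotient := \pi_quotient 1.
Definition quo_inv (a : quotient) : quotient := \pi_quotient (repr a)^-1.
Definition quo_mul (a b : quotient) : quotient := \pi_quotient (repr a * repr b).

Lemma repr_piN (x : F) : N (x^-1 * repr (\pi_quotient x)).
Proof. by apply/coset_eqP; rewrite reprK. Qed.

Lemma quo_invE (x : F) : quo_inv (\pi_quotient x) = \pi_quotient x^-1.
Proof.
apply/eqP; rewrite eq_sym; apply/coset_eqP; rewrite invgK.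
have := subgroupV sN (nN.2 _ x^-1 (repr_piN x)).
by rewrite conjgE invgK mulgA mulgA mulgV mul1g invgM invgK.
Qed.

Lemma quo_mulE (x y : F) : quo_mul (\pi_quotient x) (\pi_quotient y) =
  \pi_quotient (x * y).
Proof.
apply/eqP; rewrite eq_sym; apply/coset_eqP.
have := subgroupM sN (nN.2 _ y (repr_piN x)) (repr_piN y).
by rewrite conjgE invgM !mulgA mulgK.
Qed.

Lemma quo_mulA : associative quo_mul.
Proof.
elim/quotW=> x; elim/quotW=> y; elim/quotW=> z.
by rewrite (quo_mulE y z) (quo_mulE x y) (quo_mulE x) (quo_mulE (x * y)) mulgA.
Qed.

Lemma quo_mul1 : left_id quo_one quo_mul.
Proof. by elim/quotW=> x; rewrite quo_mulE mul1g. Qed.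

Lemma quo_mulV : left_inverse quo_one quo_inv quo_mul.
Proof. by elim/quotW=> x; rewrite quo_invE quo_mulE mulVg. Qed.

Lemma quo_1mulr : right_id quo_one quo_mul.
Proof. by elim/quotW=> x; rewrite quo_mulE mulg1. Qed.

Lemma quo_Vmulr : right_inverse quo_one quo_inv quo_mul.
Proof. by elim/quotW=> x; rewrite quo_invE quo_mulE mulgV. Qed.

HB.instance Definition _ := isGroup.Build quotient
  quo_mulA quo_mul1 quo_1mulr quo_mulV quo_Vmulr.

Lemma pi_quotient_morphism : monoid_morphism (\pi_quotient : F -> quotient).
Proof. by split=> // x y; exact/esym/quo_mulE. Qed.

End Quotient.

Arguments quotient {F} N nN.

Section HomSets.
Variables F G : groupType.
Implicit Types (W : set F) (A : set G).

Definition Hom W A : set (F -> G) :=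
  [set f | monoid_morphism f /\ f @` W `<=` A].

Definition Epi W A : set (F -> G) :=
  [set f | monoid_morphism f /\ f @` W = A].

Definition Mono W A : set (F -> G) :=
  [set f | [/\ monoid_morphism f, f @` W `<=` A & set_inj W f]].

End HomSets.

(* Main.v *)
Require Import Defs.
From HB Require Import structures.
From mathcomp Require Import all_boot.
From mathcomp Require Import all_classical.
From mathcomp Require Import ssralg ssrint intdiv.
From mathcomp Require all_fingroup all_solvable.

(** Let [K] contain the subgroup by which [F] is factored, with [F / K] cyclic of order
    [m], generated by the class of [t] ([m = 0] when this quotient is infinite), and let
    [H] be a subgroup of the relevant [X] whose order divides [m]. For a homomorphism
    [phi] in the given set, let [D] be the set of the [h] in [H] that centralise [phi K]
    and have all their conjugates by [phi F] in [H]. The set is invariant under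
    conjugation by [H], and under replacing [phi] by a [psi] that agrees with [phi] on
    [K] and has [psi f / phi f] in [D] for all [f]. These twists of [phi] correspond to
    the [h] in [D] with [(h * phi t) ^+ m = phi t ^+ m]; their number is divisible by
    [|D|], trivially if [m = 0], and otherwise by a theorem of Frobenius and Hall on
    the roots in a coset. A conjugate of [phi] by [c] in [H] is a twist of [phi] exactly
    when [c] is in [D], so each class under conjugation and twisting consists of
    [|H : D|] disjoint copies of the twists of [phi], and [|H|] divides its cardinal. *)

Set Implicit Arguments.
Unset Strict Implicit.
Unset Printing Implicit Defensive.

Local Open Scope group_scope.

(** * Roots in a coset of a finite group *)

Section CosetRoots.
Import all_fingroup all_solvable fintype finset.
Implicit Types gT : finGroupType.

(** The orbit of [v] under [B] has [#|B : 'C_B[v]|] elements, and [f] takes the value [f v] on all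
    of them. *)
Lemma dvdn_sum_orbits gT (B : {group gT}) (V : {set gT}) (f : gT -> nat) q :
  B \subset 'N(V) -> {in V & B, forall v b, f (v ^ b) = f v} ->
  {in V, forall v, q %| #|B : 'C_B[v]| * f v} -> q %| \sum_(v in V) f v.
Proof.
move=> nVB fJ qf.
have aV : [acts B, on V | 'J] by apply/subsetP => b Bb; rewrite astabsJ (subsetP nVB).
rewrite (set_partition_big _ (orbit_partition aV)) /=.
apply: dvdn_sum => _ /imsetP[v Vv ->].
rewrite (eq_bigr (fun=> f v)); last by move=> _ /imsetP[b Bb ->]; exact: fJ.
by rewrite sum_nat_const card_orbit astab1J qf.
Qed.

(** The elements are sorted by their p'-part [v]: the fibre over [v] supplies the p-part of
    [#|'C_B[v]|], the orbit of [v] the index of ['C_B[v]] in [B]. *)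
Lemma dvdn_card_constt gT (B : {group gT}) (S V : {set gT}) p :
  B \subset 'N(S) -> B \subset 'N(V) ->
  {in V, forall v, #|'C_B[v]| `_p %| #|[set y in S | y.`_p^' == v]|} ->
  #|B| `_p %| #|[set y in S | y.`_p^' \in V]|.
Proof.
move=> nSB nVB dvV; rewrite -[X in _ %| X]sum1_card.
rewrite (partition_big (fun y => y.`_p^') (mem V)) /=; last first.
  by move=> y; rewrite inE => /andP[].
have -> : \sum_(v in V) \sum_(y in [set y in S | y.`_p^' \in V] | y.`_p^' == v) 1 =
          \sum_(v in V) #|[set y in S | y.`_p^' == v]|.
  apply: eq_bigr => v Vv; rewrite -sum1_card; apply: eq_bigl => y.
  by rewrite !inE -andbA; case: eqP => [->|]; rewrite ?Vv ?andbF.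
apply: (@dvdn_sum_orbits _ B) => // [v b Vv Bb|v Vv].
  rewrite -(cardJg [set y in S | y.`_p^' == v] b); apply: eq_card => y.
  rewrite mem_conjg !inE memJ_norm ?groupV ?(subsetP nSB) // consttJ.
  by congr (_ && _); rewrite -(inj_eq (conjg_inj b) _ v) conjgKV.
rewrite -[#|B|](LagrangeI B 'C[v]) partnM ?cardG_gt0 // [X in X %| _]mulnC.
by rewrite -indexgI dvdn_mul ?dvdn_part ?dvV.
Qed.

(** Induction on [#|Q|], factoring out a subgroup [<[z]>] of order [p] in [Q :&: 'Z(P)]. The powers
    with exponent [#|Q / <[z]>|] then differ by a central power of [z], which vanishes on raising to
    the power [p]. *)
Lemma expg_mull_pgroup gT (P Q : {group gT}) (p : nat) s h :
  p.-group P -> Q <| P -> s \in P -> h \in Q ->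
  (h * s) ^+ #|Q| = s ^+ #|Q|.
Proof.
have [n] := ubnP #|Q|; elim: n gT P Q s h => // n IHn gT P Q s h leQn.
move=> pP nQP Ps Qh.
have [Q1 | ntQ] := eqsVneq Q 1.
  by move: Qh; rewrite Q1 => /set1P->; rewrite mul1g.
have ntZ : Q :&: 'Z(P) != 1 by exact: meet_center_nil (pgroup_nil pP) nQP ntQ.
have sQP := normal_sub nQP.
have pQZ : p.-group (Q :&: 'Z(P)) := pgroupS (subset_trans (subsetIl _ _) sQP) pP.
have [p_pr p_dvd _] := pgroup_pdiv pQZ ntZ.
have [z zQZ oz] := Cauchy p_pr p_dvd.
have /setIP[Qz Zz] := zQZ.
have sZP : <[z]> \subset 'Z(P) by rewrite cycle_subG.
have nZP : <[z]> <| P by apply: sub_center_normal.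
have sZQ : <[z]> \subset Q by rewrite cycle_subG.
have oQ : (#|Q / <[z]>| * p = #|Q|)%N.
  by rewrite card_quotient ?(subset_trans sQP) ?normal_norm // mulnC -oz Lagrange.
have qlt : #|Q / <[z]>| < n.
  by rewrite -ltnS (leq_trans _ leQn) // ltnS -oQ ltn_Pmulr ?prime_gt1 ?cardG_gt0.
have NP x : x \in P -> x \in 'N(<[z]>) by exact/subsetP/normal_norm.
have Ph : h \in P := subsetP sQP h Qh.
have := IHn _ (P / <[z]>)%G (Q / <[z]>)%G (coset <[z]> s) (coset <[z]> h) qlt
   (quotient_pgroup _ pP) (quotient_normal _ nQP) (mem_quotient _ Ps) (mem_quotient _ Qh).
rewrite -morphM ?NP // -!morphX ?groupM ?NP // => E.
have : (h * s) ^+ #|Q / <[z]>| \in <[z]> :* s ^+ #|Q / <[z]>|.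
  apply/rcoset_kercosetP; rewrite ?groupX ?groupM ?NP //.
case/rcosetP=> _ /cycleP[i ->] Ei.
have cz : commute (z ^+ i) (s ^+ #|Q / <[z]>|).
  apply/commuteX2/commute_sym; have /centerP[_] := Zz; move=> /(_ s Ps) //.
by rewrite -oQ !expgM Ei expgMn // (expgAC z) -[in z ^+ p]oz expg_order expg1n mul1g.
Qed.

(** An element with p'-part [v] is [w * v] with [w] a p-element commuting with [v]; as [v ^+ n = 1],
    the root condition concerns [w] alone. Two such elements of [B :* s] centralise [v], hence so
    does their quotient, which lies in [B]. *)
Lemma pconstt_fiber gT (B : {group gT}) s y0 n (p : nat) :
  s \in 'N(B) -> y0 \in B :* s -> y0 ^+ n = 1 ->
  [set y in [set y in B :* s | y ^+ n == 1] | y.`_p^' == y0.`_p^'] =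
  [set w in 'C_B[y0.`_p^'] :* y0.`_p | p.-elt w & w ^+ n == 1] :* y0.`_p^'.
Proof.
move=> nBs By0 y0n; set v := y0.`_p^'; set w0 := y0.`_p.
have vn : v ^+ n = 1 by rewrite -consttX y0n constt1.
have Ew y : y.`_p^' = v -> y = y.`_p * v by move=> <-; rewrite consttC.
have cC (y : gT) : commute y.`_p y.`_p^' by apply: commuteX2.
have cw0 : commute w0 v := cC y0.
have w0E : w0 = y0 * v^-1 by rewrite -[in RHS](consttC p y0) mulgK.
have BE y : (y \in B :* s) = (y * y0^-1 \in B).
  by move: By0; rewrite -mem_rcoset => /rcoset_eqP->.
apply/setP=> y; rewrite mem_rcoset !inE BE; apply/idP/idP.
  case/andP=> /andP[By /eqP yn] /eqP vE.
  have yw : y * v^-1 = y.`_p by rewrite {1}(Ew y vE) mulgK.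
  rewrite yw mem_rcoset finset.in_setI p_elt_constt -consttX yn constt1 eqxx !andbT.
  have -> : y.`_p * w0^-1 = y * y0^-1.
    by rewrite -yw w0E invgM invgK mulgA mulgVK.
  have Cv x : x.`_p^' = v -> x \in 'C[v].
    by move=> <-; rewrite cent1C groupX ?cent1id.
  by rewrite By; apply: groupM; rewrite ?groupV; apply: Cv.
case/and3P=> /rcosetP[c /setIP[Bc /cent1P cv] Ey] pw wn.
have Ey' : y = c * w0 * v by rewrite -Ey mulgVK.
have cwv : commute (y * v^-1) v by rewrite Ey; apply/commute_sym/commuteM => //; apply/commute_sym.
have Ey2 : y = y * v^-1 * v by rewrite mulgVK.
have wv : w0 * v = y0 := consttC p y0.
rewrite {1}Ey' -(mulgA c) wv mulgK Bc /=.
rewrite {1}Ey2 expgMn // (eqP wn) mul1g vn eqxx /=.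
rewrite Ey2 consttM // (constt1P _) ?mul1g; last by rewrite p_eltNK.
by rewrite constt_p_elt // p_elt_constt.
Qed.

(** Removing [v] leaves p-elements in a coset of ['C_B[v]]. Its representative is the p-part of some
    [y0] in the fibre, which normalises ['C_B[v]] because [y0] normalises [B] and centralises
    [v]. *)
Lemma card_pconstt_fiber gT (B : {group gT}) s v n (p : nat) :
  s \in 'N(B) ->
  (forall w, w \in 'N('C_B[v]) -> w ^+ n = 1 -> p.-elt w ->
    #|'C_B[v]| `_p %| #|[set y in 'C_B[v] :* w | p.-elt y & y ^+ n == 1]|) ->
  #|'C_B[v]| `_p %| #|[set y in [set y in B :* s | y ^+ n == 1] | y.`_p^' == v]|.
Proof.
move=> nBs IH; set X := finset (fun y => _ && (y.`_p^' == v)); have [-> | [y0]] := set_0Vmem X.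
  by rewrite cards0 dvdn0.
rewrite !inE => /andP[/andP[By0 /eqP y0n] /eqP vE]; rewrite /X -vE.
rewrite (pconstt_fiber p nBs By0 y0n) card_rcoset vE IH ?p_elt_constt //; last first.
  by rewrite -consttX y0n constt1.
have nB : y0 \in 'N(B) by case/rcosetP: By0 => b Bb ->; rewrite groupM // (subsetP (normG B)).
have nBw : y0.`_p \in 'N(B) by rewrite groupX.
have nvw : y0.`_p \in 'C[v].
  by rewrite -vE /constt; apply/cent1P/commuteX2.
by rewrite inE conjIg (normP nBw) conjGid.
Qed.

Lemma norm_coset_roots gT (B : {group gT}) u m : u \in 'N(B) ->
  B \subset 'N([set y in B :* u | y ^+ m == 1]).
Proof.
move=> nBu; apply/subsetP=> b Bb; rewrite inE; apply/subsetP=> _ /imsetP[y + ->].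
rewrite !inE -conjXg conjg_eq1 => /andP[/rcosetP[c Bc ->] ->]; rewrite andbT.
have -> : (c * u) ^ b = c ^ b * (b^-1 * b ^ u^-1) * u.
  by rewrite !conjgE invgK !mulgA mulgVK mulgK.
by rewrite mem_rcoset mulgK; apply: groupM; [exact: groupJ | apply: groupM]; rewrite ?memJ_norm ?groupV.
Qed.

(* Sort the elements y of the coset B :* u, with u a p-element, by their p'-part v, which
   lies in B. Non-central v contribute a multiple of the p-part of #|B| by induction, the
   centraliser of v replacing B; the central ones contribute #|Z| * #|N|, where N is the
   set to be counted and #|Z| is prime to p. *)
Lemma dvdn_card_coset_p_elt gT (B : {group gT}) u (p : nat) : u \in 'N(B) ->
  #|B| `_p %| #|[set y in B :* u | p.-elt y]|.
Proof.
have [n] := ubnP #|B|; elim: n B u => // n IHn B u0 ltBn nBu0.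
have [-> | [u]] := set_0Vmem [set y in B :* u0 | p.-elt y].
  by rewrite cards0 dvdn0.
rewrite inE => /andP[Bu pu]; move: (Bu) => /rcoset_eqP<-.
have nBu : u \in 'N(B).
  by case/rcosetP: Bu => b Bb ->; rewrite groupM // (subsetP (normG B)).
have B'p y : y \in B :* u -> y.`_p^' \in B.
  move=> /[dup] Buy /rcosetP[b Bb yE].
  have nBy : y \in 'N(B) by rewrite yE groupM // (subsetP (normG B)).
  have pBy : p.-elt (coset B y).
    rewrite yE morphM ?(subsetP (normG B) b) //= coset_id ?mul1g //.
    exact: morph_p_elt.
  apply: coset_idr; first by rewrite groupX.
  by rewrite morph_constt //; apply/constt1P; rewrite p_eltNK.
(* The exponent 0 makes the root condition vacuous: [S] is the whole coset, in a form to which the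
   lemmas on roots apply. *)
pose S := [set y in B :* u | y ^+ 0 == 1]; pose N := [set y in B :* u | p.-elt y].
pose Z := [set v in 'Z(B) :&: 'C[u] | p^'.-elt v].
have SE y : (y \in S) = (y \in B :* u) by rewrite inE expg0 eqxx andbT.
have dvdV : #|B| `_p %| #|[set y in S | y.`_p^' \in B :\: 'Z(B)]|.
  apply: dvdn_card_constt => [||v /setDP[Bv nZv]].
  - exact: norm_coset_roots.
  - by rewrite normsD ?normG ?gFnorm.
  apply: card_pconstt_fiber => // w nw _ _.
  have -> : [set y in 'C_B[v] :* w | p.-elt y & y ^+ 0 == 1] =
            [set y in 'C_B[v] :* w | p.-elt y].
    by apply/setP=> y; rewrite !inE expg0 eqxx andbT.
  apply: IHn => //; apply: leq_trans (proper_card _) _; last exact: ltBn.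
  rewrite properE subsetIl /=; apply: contra nZv => /subsetIP[_ cBv].
  by apply/centerP; split=> // y By; apply/cent1P; rewrite cent1C (subsetP cBv).
have ZNE v w : v \in Z -> w \in N ->
    [/\ v * w \in S, (v * w).`_p^' = v & (v * w).`_p = w].
  rewrite inE => /andP[/setIP[/centerP[Bv cBv] cuv] p'v].
  rewrite inE => /andP[Buw pw]; have cvw : commute v w.
    case/rcosetP: Buw => b Bb ->; apply: commuteM; first exact: cBv.
    exact/cent1P.
  have [pw1 pv1] : w.`_p^' = 1 /\ v.`_p = 1.
    by split; apply/constt1P; rewrite ?p_eltNK.
  split; last 2 first.
  - by rewrite consttM // pw1 mulg1 constt_p_elt.
  - by rewrite consttM // pv1 mul1g constt_p_elt.
  by rewrite SE; case/rcosetP: Buw => b Bb ->; rewrite mulgA mem_rcoset mulgK groupM.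
(* Multiplication of [Z] by [N] is inverted by splitting [y] into its p'-part and its p-part; a
   p'-part central in [B] commutes with [u] because it commutes with [y]. *)
have cardZ : #|[set y in S | y.`_p^' \in 'Z(B)]| = (#|Z| * #|N|)%N.
  rewrite -cardsX -(@card_in_imset _ _ (fun vw => vw.1 * vw.2)) => [|[v w] [v' w']] /=.
    apply: eq_card => y; apply/idP/imsetP.
      rewrite inE SE => /andP[Buy Zv]; exists (y.`_p^', y.`_p); last first.
        by rewrite /= -{1}(consttC p y) /constt; apply: commuteX2.
      have /centerP[Bv cBv] := Zv.
      have cvy : commute y.`_p^' y.
        by rewrite /constt; apply/commute_sym/commuteX.
      apply/setXP; split=> /=; apply/setIdP; split; rewrite ?p_elt_constt //.
        apply/setIP; split=> //.
        case/rcosetP: Buy => b Bb yE.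
        have -> : u = b^-1 * y by rewrite yE mulKg.
        by apply/cent1P; apply: commuteM => //; apply: cBv; rewrite groupV.
      have -> : y.`_p = (y.`_p^')^-1 * y.
        rewrite -[X in _ * X](consttC p y).
        have -> : y.`_p * y.`_p^' = y.`_p^' * y.`_p by apply: commuteX2.
        by rewrite mulKg.
      case/rcosetP: Buy => b Bb yE; rewrite [X in _ * X]yE mulgA mem_rcoset mulgK.
      by rewrite groupM ?groupV.
    case=> -[v w] /setXP[/= Zv Nw] -> /=; have [Sy vE _] := ZNE v w Zv Nw.
    by apply/setIdP; rewrite vE; case/setIdP: Zv => /setIP[].
  case/setXP=> Zv Nw /setXP[/= Zv' Nw'] E.
  have [_ v1 w1] := ZNE v w Zv Nw; have [_ v2 w2] := ZNE v' w' Zv' Nw'.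
  by congr (_, _); [rewrite -v1 E | rewrite -w1 E].
(* [Z] is the set of all p'-elements of the abelian group ['Z(B) :&: 'C[u]], hence a subgroup of
   order prime to [p]. *)
have pZ : coprime (#|B| `_p) #|Z|.
  have abZ : nilpotent ('Z(B) :&: 'C[u]).
    by apply/abelian_nil/(abelianS (subsetIl _ _))/center_abelian.
  have -> : Z = 'O_p^'('Z(B) :&: 'C[u]).
    apply/setP=> v; rewrite inE; apply/andP/idP=> [[Zv p'v]|Ov].
      by rewrite (mem_Hall_pcore (nilpotent_pcore_Hall _ abZ)).
    have Zv := subsetP (pcore_sub _ _) v Ov.
    by rewrite -(mem_Hall_pcore (nilpotent_pcore_Hall _ abZ)).
  by apply: pnat_coprime (pcore_pgroup _ _); apply: part_pnat.
rewrite -(@Gauss_dvdr _ #|Z|) // -cardZ -(dvdn_addr _ dvdV) addnC.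
have -> : (#|[set y in S | y.`_p^' \in 'Z(B)]| +
           #|[set y in S | y.`_p^' \in B :\: 'Z(B)]| = #|B|)%N.
  rewrite -(card_rcoset B u) -[RHS](cardsID [set y | y.`_p^' \in 'Z(B)]).
  congr (_ + _)%N; apply: eq_card => y; rewrite !inE expg0 eqxx andbT //.
  by case: (boolP (y \in B :* u)) => [/B'p->|]; rewrite ?andbF ?andbT.
exact: dvdn_part.
Qed.

(** Once the coset has one root [u] that is a p-element, all its p-elements [y] are roots: a
    conjugate of [y] lies in the same coset and in a Sylow subgroup [P] containing [u], where
    [expg_mull_pgroup] applies to [P :&: B]. *)
Lemma dvdn_card_coset_p_roots gT (B : {group gT}) u (p n : nat) : u \in 'N(B) ->
  #|B| `_p %| n -> #|B| `_p %| #|[set y in B :* u | p.-elt y & y ^+ n == 1]|.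
Proof.
move: u => u0 nBu0 dvn.
have [-> | [u]] := set_0Vmem [set y in B :* u0 | p.-elt y & y ^+ n == 1].
  by rewrite cards0 dvdn0.
rewrite inE => /and3P[Bu pu /eqP un]; move: (Bu) => /rcoset_eqP<-.
have nBu : u \in 'N(B).
  by case/rcosetP: Bu => b Bb ->; rewrite groupM // (subsetP (normG B)).
suff -> : [set y in B :* u | p.-elt y & y ^+ n == 1] = [set y in B :* u | p.-elt y].
  exact: dvdn_card_coset_p_elt.
apply/setP=> y; rewrite !inE; have [Buy /=|//] := boolP (y \in B :* u).
have [py /=|//] := boolP (p.-elt y).
have nBU : <[u]> \subset 'N(B) by rewrite cycle_subG.
have [P sylP sUP] := Sylow_superset (joing_subr B <[u]>) pu.
have Gy : y \in B <*> <[u]>.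
  case/rcosetP: Buy => b Bb ->; rewrite groupM //.
    exact: (subsetP (joing_subl _ _)).
  by rewrite (subsetP (joing_subr _ _)) ?cycle_id.
have [|x Gx] := Sylow_Jsub sylP _ py; first by rewrite cycle_subG.
rewrite -cycleJ cycle_subG => Pyx.
have Buyx : y ^ x \in B :* u.
  have nBx : x \in 'N(B).
    by move: x Gx {Pyx}; apply/subsetP; rewrite join_subG normG.
  have nBy : y \in 'N(B) by case/rcosetP: Buy => b Bb ->; rewrite groupM // (subsetP (normG B)).
  (* Modulo [B] the group [B <*> <[u]>] is generated by the class of [u], so conjugation by [x] does
     not move this class. *)
  have: coset B (y ^ x) = coset B u.
    rewrite morphJ //=; have -> : coset B y = coset B u.
      by case/rcosetP: Buy => b Bb ->; rewrite morphM ?(subsetP (normG B) b) //= coset_id ?mul1g.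
    move: Gx; rewrite /= norm_joinEr // => /mulsgP[b v Bb Uv ->].
    rewrite morphM ?(subsetP nBU v) ?(subsetP (normG B) b) //= (coset_id Bb) mul1g.
    case/cycleP: Uv => i ->; rewrite morphX //; apply/conjg_fixP/commgP/commuteX.
    exact: commute_refl.
  by move/rcoset_kercosetP; rewrite groupJ //; apply.
have Pu : u \in P by rewrite -cycle_subG.
have [h Bh yxE] := rcosetP Buyx.
have Ph : h \in P :&: B.
  by rewrite inE Bh andbT -(mulgK u h) -yxE groupM ?groupV.
have nQ : P :&: B <| P.
  have [sPG _ _] := and3P sylP.
  rewrite /normal subsetIl normsI ?normG // (subset_trans sPG) //.
  by rewrite join_subG normG.
have := expg_mull_pgroup (pHall_pgroup sylP) nQ Pu Ph; rewrite -yxE => yxQ.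
have dvQ : #|P :&: B| %| n.
  apply: dvdn_trans dvn; rewrite -[X in X %| _](@part_pnat_id p).
    by apply: partn_dvd; rewrite ?cardG_gt0 // cardSg // subsetIr.
  exact: pgroupS (subsetIl _ _) (pHall_pgroup sylP).
case/dvdnP: dvQ un => k ->; rewrite mulnC !expgM => un.
by rewrite -(conjg_eq1 _ x) !conjXg yxQ un eqxx.
Qed.

(** The theorem of Frobenius and Hall, one prime at a time: after sorting by p'-parts, each fibre
    reduces to p-elements in a coset of a centraliser. *)
Lemma dvdn_card_coset_roots gT (B : {group gT}) s n : s \in 'N(B) ->
  #|B| %| n -> #|B| %| #|[set y in B :* s | y ^+ n == 1]|.
Proof.
move=> nBs dvn; apply/dvdn_partP=> [|p _]; first exact: cardG_gt0.
have -> : [set y in B :* s | y ^+ n == 1] =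
    [set y in [set y in B :* s | y ^+ n == 1] | y.`_p^' \in [set: gT]].
  by apply/setP=> y; rewrite !inE andbT.
apply: dvdn_card_constt => [||v _].
- exact: norm_coset_roots.
- by apply/subsetP=> b _; rewrite inE finset.subsetT.
apply: card_pconstt_fiber => // w nw wn pw; apply: dvdn_card_coset_p_roots => //.
apply: dvdn_trans (dvdn_trans (dvdn_part p _) dvn).
by rewrite partn_dvd ?cardG_gt0 // cardSg // subsetIl.
Qed.
End CosetRoots.

Local Open Scope classical_set_scope.
Local Open Scope card_scope.
Local Open Scope group_scope.

(** * Divisibility of cardinals *)

Lemma card_eq_ex (T U : Type) (A : set T) (B : set U) (u0 : U) :
  A #= B -> exists f : T -> U, set_bij A B f.
Proof.
elim/Ppointed: U => U in B u0 *; first by case: (no u0).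
by move/card_set_bijP.
Qed.

(** The map [b |-> (a b, c b)] is a bijection of [B] onto the product of [A] and the image of [c]:
    by the third condition the first coordinate can be changed at will while the second is kept. *)
Lemma card_dvd_intro (T U V : Type) (A : set T) (B : set U) (a : U -> T) (c : U -> V) :
  (forall b, B b -> A (a b)) ->
  (forall b b', B b -> B b' -> a b = a b' -> c b = c b' -> b = b') ->
  (forall x b, A x -> B b -> exists b', [/\ B b', a b' = x & c b' = c b]) ->
  card_dvd A B.
Proof.
move=> aA inj sur; exists V, (c @` B); apply: card_esym.
suff -> : A `*` (c @` B) = (fun b => (a b, c b)) @` B.
  apply: inj_card_eq => b b' /set_mem Bb /set_mem Bb' [ab cb]; exact: inj.
apply/seteqP; split=> [[x v] /= [Ax [b Bb <-]]|_ [b Bb <-]] /=.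
  by have [b' [Bb' <- <-]] := sur x b Ax Bb; exists b'.
by split; [exact: aA | exists b].
Qed.

(** Converse of [card_dvd_intro]. The second coordinate takes values in [U] itself, so that such
    data for many subsets of [U] have one type and can be chosen simultaneously. *)
Lemma card_dvd_elim (T U : Type) (A : set T) (B : set U) (x0 : T) : A x0 ->
  card_dvd A B -> exists (a : U -> T) (c : U -> U),
  [/\ forall b, B b -> A (a b),
      forall b b', B b -> B b' -> a b = a b' -> c b = c b' -> b = b' &
      forall x b, A x -> B b -> exists b', [/\ B b', a b' = x & c b' = c b]].
Proof.
move=> Ax0 [V [C BAC]].
have [B0|/set0P[b0 Bb0]] := eqVneq B set0.
  by exists (fun _ => x0), id; rewrite B0; split.
have [v0 Cv0] : exists v, C v.
  have : B !=set0 by exists b0.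
  move/set0P; rewrite -(card_eq0 (U := T * V)) (card_eql BAC) card_eq0 => /set0P[[x v] [_ Cv]].
  by exists v.
have [f [fAC fI fS]] := card_eq_ex (x0, v0) BAC.
have /choice[g gP] : forall v, exists b, C v -> B b /\ f b = (x0, v).
  move=> v; have [Cv|nCv] := pselect (C v); last by exists b0.
  by have [|b Bb fb] := fS (x0, v); [split | exists b].
have fC b : B b -> C (f b).2 by move=> Bb; have [] := fAC b Bb.
exists (fun b => (f b).1), (fun b => g (f b).2); split.
- by move=> b Bb; have [] := fAC b Bb.
- move=> b b' Bb Bb' ab cb; apply: fI; rewrite ?inE //.
  have [_ g1] := gP _ (fC b Bb); have [_ g2] := gP _ (fC b' Bb').
  move: g1; rewrite cb g2 => -[]; case: (f b) (f b') ab => [? ?] [? ?] /= -> ->.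
  by [].
- move=> x b Ax Bb; have [|b' Bb' fb'] := fS (x, (f b).2).
    by split=> //; exact: fC.
  by exists b'; rewrite fb'.
Qed.

Lemma card_dvd_set0 (T U : Type) (A : set T) : card_dvd A (@set0 U).
Proof.
by exists U, set0; rewrite setX0 card_eq_sym card_eq0.
Qed.

Lemma card_dvd_eqr (T U V : Type) (A : set T) (B : set U) (C : set V) :
  B #= C -> card_dvd A B -> card_dvd A C.
Proof. by move=> BC [W [D BAD]]; exists W, D; rewrite -(card_eql BC). Qed.

Lemma card_dvd_eql (T T' U : Type) (A : set T) (A' : set T') (B : set U) :
  A !=set0 -> A #= A' -> card_dvd A B -> card_dvd A' B.
Proof.
move=> [x0 Ax0] AA' /(card_dvd_elim Ax0)[a [c [aA inj sur]]].
have [y0 Ay0] : exists y, A' y.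
  have : A !=set0 by exists x0.
  by move/set0P; rewrite -(card_eq0 (U := T')) (card_eql AA') card_eq0 => /set0P[y]; exists y.
have [f [fA fI fS]] := card_eq_ex y0 AA'.
apply: (card_dvd_intro (a := f \o a) (c := c)) => /=.
- by move=> b /aA/fA.
- by move=> b b' Bb Bb' ab cb; apply: inj => //; apply: fI; rewrite ?inE //; exact: aA.
- by move=> _ b /fS[x Ax <-] /(sur _ _ Ax)[b' [Bb' <- <-]]; exists b'.
Qed.

Lemma card_dvd_trans (S T U : Type) (A : set S) (B : set T) (C : set U) :
  A !=set0 -> B !=set0 -> card_dvd A B -> card_dvd B C -> card_dvd A C.
Proof.
move=> [x0 Ax0] [y0 By0] /(card_dvd_elim Ax0)[a [c [aA inj sur]]].
move=> /(card_dvd_elim By0)[a' [c' [aB inj' sur']]].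
apply: (card_dvd_intro (a := a \o a') (c := fun u => (c (a' u), c' u))) => /=.
- by move=> b /aB/aA.
- by move=> b b' Cb Cb' ab [cb cb']; apply: inj' => //; apply: inj => //; exact: aB.
- move=> x b Ax Cb; have [y [By yx yc]] := sur x (a' b) Ax (aB _ Cb).
  by have [b' [Cb' b'y b'c]] := sur' y b By Cb; exists b'; rewrite b'y yx yc b'c.
Qed.

(** Coordinates are chosen for each class as a set, so they depend on the class only; the
    complementary coordinate of a point is its class together with its second coordinate there. *)
Lemma card_dvd_partition (T U : Type) (A : set T) (B : set U) (R : U -> U -> Prop) :
  A !=set0 -> (forall x, B x -> R x x) ->
  (forall x y, B x -> B y -> R x y -> [set z | B z /\ R x z] = [set z | B z /\ R y z]) ->
  (forall x, B x -> card_dvd A [set z | B z /\ R x z]) -> card_dvd A B.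
Proof.
move=> [x0 Ax0] Rxx Req dvR; pose cl x := [set z | B z /\ R x z].
pose spec (X : set U) (ac : (U -> T) * (U -> U)) :=
  [/\ forall b, X b -> A (ac.1 b),
      forall b b', X b -> X b' -> ac.1 b = ac.1 b' -> ac.2 b = ac.2 b' -> b = b' &
      forall x b, A x -> X b -> exists b', [/\ X b', ac.1 b' = x & ac.2 b' = ac.2 b]].
have /choice[ac acP] : forall X, exists ac, (exists2 x, B x & X = cl x) -> spec X ac.
  move=> X; have [[x Bx ->]|nX] := pselect (exists2 x, B x & X = cl x).
    have [a [c acP]] := card_dvd_elim Ax0 (dvR x Bx).
    by exists (a, c).
  by exists (fun=> x0, id).
have acl x : B x -> spec (cl x) (ac (cl x)) by move=> Bx; apply: acP; exists x.
have clx x : B x -> cl x x by split=> //; exact: Rxx.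
have clE x y : B x -> cl x y -> cl y = cl x.
  by move=> Bx [By Rxy]; apply/esym/Req.
apply: (card_dvd_intro (a := fun x => (ac (cl x)).1 x)
                       (c := fun x => (cl x, (ac (cl x)).2 x))).
- by move=> b Bb; have [h _ _] := acl b Bb; apply/h/clx.
- move=> b b' Bb Bb' ab [clbb' cb]; have [_ h _] := acl b Bb.
  have Xb := clx b Bb; have Xb' : cl b b' by rewrite clbb'; exact: clx.
  by apply: h; rewrite // ?ab ?cb clbb'.
- move=> x b Ax Bb; have [_ _ h] := acl b Bb.
  have [b' [Xb' xb' cb']] := h x b Ax (clx b Bb).
  by exists b'; have [Bb' _] := Xb'; rewrite (clE b b' Bb Xb') xb' cb'.
Qed.

Lemma card_dvd_II (d n : nat) : (0 < d)%N -> card_dvd `I_d `I_n <-> (d %| n)%N.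
Proof.
move=> d0; split=> [|/dvdnP[q ->]].
  move=> /(card_dvd_elim (d0 : `I_d 0%N))[a [c [aA inj sur]]].
  have : finite_set (c @` `I_n) by apply: finite_image; exists n.
  move=> -[e ce]; have [f [fA fI fS]] := card_eq_ex 0%N ce.
  (* With the values of [c] numbered by [f] below [e], the two coordinates become remainder and
     quotient in a division by [d]; this maps [I_n] bijectively onto the numbers below [d * e]. *)
  have : (fun b => a b + d * f (c b))%N @` `I_n #= `I_n.
    apply: inj_card_eq => b b' /[!inE] Bb Bb' E.
    have ab : a b = a b'.
      have := congr1 (modn^~ d) E.
      by rewrite /= ![(_ + d * _)%N]addnC ![(d * _)%N]mulnC !modnMDl !modn_small //; exact: aA.
    move: E; rewrite ab => /addnI/eqP; rewrite eqn_pmul2l // => /eqP E.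
    by apply: inj => //; apply: fI; rewrite ?inE.
  have -> : (fun b => a b + d * f (c b))%N @` `I_n = `I_(d * e).
    apply/seteqP; split=> [_ [b Bb <-]|m /= lem].
      have : (f (c b) < e)%N by apply: fA; exists b.
      rewrite /= => lt; apply: (@leq_trans (d * (f (c b)).+1)).
        by rewrite mulnS ltn_add2r; exact: aA.
      by rewrite leq_mul2l lt orbT.
    have [|_ [b Bb <-] fb] := fS (m %/ d)%N; first by rewrite /= ltn_divLR // mulnC.
    have [|b' [Bb' ab' cb']] := sur (m %% d)%N b _ Bb; first by rewrite /= ltn_mod.
    by exists b' => //; rewrite ab' cb' fb addnC mulnC -divn_eq.
  by move/card_eq_II <-; rewrite dvdn_mulr.
apply: (@card_dvd_intro _ _ _ _ _ (modn^~ d) (divn^~ d)).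
- by move=> b _ /=; rewrite ltn_mod.
- by move=> b b' _ _ /= md dv; rewrite (divn_eq b d) md dv -divn_eq.
- move=> x b /= ltx ltb; exists (b %/ d * d + x)%N; split=> /=.
  + apply: (@leq_trans ((b %/ d).+1 * d)); first by rewrite mulSn addnC ltn_add2r.
    by rewrite leq_mul2r ltn_divLR // ltb orbT.
  + by rewrite modnMDl modn_small.
  + by rewrite divnMDl // (divn_small ltx) ?addn0.
Qed.

Lemma card_dvd_finite (T U : Type) (A : set T) (B : set U) :
  A !=set0 -> B !=set0 -> card_dvd A B -> finite_set B -> finite_set A.
Proof.
move=> [x0 Ax0] [b0 Bb0] /(card_dvd_elim Ax0)[a [c [aA inj sur]]] finB.
apply: sub_finite_set (finite_image a finB) => x Ax.
by have [b [Bb <- _]] := sur x b0 Ax Bb0; exists b.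
Qed.

(** Lagrange's theorem: [r h] represents the coset [D h], and is the same for all its elements
    because [xget] depends only on the set. *)
Lemma card_dvd_subgroup (G : groupType) (D H : set G) :
  subgroup D -> D `<=` H -> subgroup H -> card_dvd D H.
Proof.
move=> sD sDH sH; pose r h := xget 1 [set x | D (h * x^-1)].
have rP h : D (h * (r h)^-1).
  by apply: (@xgetPex _ 1 [set x | D (h * x^-1)]); exists h; rewrite /= mulgV; exact: (subgroup1 sD).
have rM d h : D d -> r (d * h) = r h.
  move=> Dd; congr xget; apply/seteqP; split=> x /= Dx; last first.
    by rewrite -mulgA; exact: (subgroupM sD).
  by rewrite -(mulKg d (h * x^-1)) (mulgA d); apply: (subgroupM sD) => //; exact: (subgroupV sD).
have rE h : r h = (h * (r h)^-1)^-1 * h by rewrite invgM invgK mulgVK.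
apply: (card_dvd_intro (a := fun h => h * (r h)^-1) (c := r)) => //.
- by move=> h h' _ _ + rhE; rewrite rhE => /mulIg.
- move=> d h Dd Hh; have rh : r (d * r h) = r h.
    rewrite rM // -[RHS](rM (h * (r h)^-1)^-1) -?rE //; exact: (subgroupV sD).
  exists (d * r h); split=> //; last by rewrite rh mulgK.
  apply: (subgroupM sH) => //; first exact: sDH.
  rewrite rE; apply: (subgroupM sH) Hh; apply: (subgroupV sH); exact: sDH.
Qed.

Lemma card_dvd_nat (d : nat) : (0 < d)%N -> card_dvd `I_d [set: nat].
Proof.
move=> d0; apply: (@card_dvd_intro _ _ _ _ _ (modn^~ d) (divn^~ d)).
- by move=> b _ /=; rewrite ltn_mod.
- by move=> b b' _ _ /= md dv; rewrite (divn_eq b d) md dv -divn_eq.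
- move=> x b /= ltx _; exists (b %/ d * d + x)%N; split=> //=.
    by rewrite modnMDl modn_small.
  by rewrite divnMDl // (divn_small ltx) addn0.
Qed.

(* By Zorn's lemma, B is a disjoint union of countably infinite sets, up to a finite
   remainder that is absorbed by one of them. *)
Lemma card_dvd_infinite (U : Type) (B : set U) (d : nat) :
  (0 < d)%N -> infinite_set B -> card_dvd `I_d B.
Proof.
move=> d0 infB.
have [E [ED tE maxE]] :=
  ex_maximal_disjoint_subcollection id [set X : set U | X `<=` B /\ X #= [set: nat]].
have finR : finite_set (B `\` \bigcup_(X in E) X).
  apply: contrapT => /infiniteP/card_subP[C Cnat CR].
  have nEC : ~ E C.
    move=> EC; have [x Cx] : C !=set0.
      by apply/set0P; rewrite -(card_eq0 (U := nat)) (card_eql Cnat) card_eq0; apply/set0P; exists 0%N.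
    by have [_] := CR x Cx; apply; exists C.
  apply: (maxE (E `|` [set C])).
  - by split=> [X EX|]; [left | move=> /(_ C (or_intror erefl))].
  - by move=> X [/ED//|->]; split=> // x /CR[].
  - have CE X x : E X -> X x -> ~ C x by move=> EX Xx /CR[_]; apply; exists X.
    move=> X Y [EX|->] [EY|->] //.
    + exact: tE.
    + by move=> [x [Xx Cx]]; case: (CE X x).
    + by move=> [x [Cx Yx]]; case: (CE Y x).
have [X0 EX0] : E !=set0.
  apply/set0P/eqP => E0; apply: infB; move: finR; rewrite E0 bigcup_set0 setD0 //.
(* The default [X0] is the value of [p] on the finite remainder: this block absorbs it. *)
pose p x := xget X0 [set X | E X /\ X x].
have Ep x : E (p x).
  by rewrite /p; case: xgetP => [X _ []|].
have pE X x : E X -> X x -> p x = X.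
  move=> EX Xx; apply: xget_unique => // Y [EY Yx].
  by apply: tE => //; exists x.
apply: (card_dvd_partition (R := fun x y => p x = p y)) => //.
- by exists 0%N.
- by move=> x y _ _ ->.
move=> x Bx; set Z := [set z : U | _].
have XZ : p x `<=` Z.
  by move=> z pz; split; [apply: (ED _ (Ep x)).1 | rewrite (pE _ _ (Ep x) pz)].
have ZX : Z `<=` p x `|` (B `\` \bigcup_(X in E) X).
  move=> z [Bz pz]; have [[X EX Xz]|nz] := pselect ((\bigcup_(X in E) X) z); last by right.
  by left; rewrite pz (pE X).
have [_ pxn] := ED _ (Ep x).
apply: card_dvd_eqr (card_dvd_nat d0); apply: card_esym; apply: eq_card_nat.
  apply: sub_countable (subset_card_le ZX) _.
  have -> : p x `|` (B `\` \bigcup_(X in E) X) =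
      \bigcup_(b in [set: bool]) (if b then p x else B `\` \bigcup_(X in E) X).
    apply/seteqP; split=> [z [pz|Rz]|z [[] _ pz]]; [exists true|exists false|left|right] => //.
  apply: bigcup_countable => // -[] _; last exact: finite_set_countable.
  by apply: sub_countable (card_lexx _); rewrite (card_le_eql pxn).
by move=> finZ; apply: infinite_nat; rewrite -(eq_finite_set pxn); apply: sub_finite_set finZ.
Qed.

Lemma card_finset_image (T : finType) (U : Type) (f : T -> U) (J : {set T}) :
  injective f -> f @` [set` J] #= `I_#|J|.
Proof.
move=> fI; rewrite (card_eql (inj_card_eq _)); last by move=> x y _ _ /fI.
rewrite card_eq_sym (card_eql card_II).
suff -> : [set` J] = (@enum_val T (mem J)) @` [set: 'I_#|J|].
  by rewrite card_eq_sym; apply: inj_card_eq => x y _ _; exact: enum_val_inj.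
apply/seteqP; split=> [x /= Jx|_ [i _ <-]] /=; last exact: enum_valP.
by exists (enum_rank_in Jx x); rewrite ?enum_rankK_in.
Qed.

(** * Roots in a coset inside an arbitrary group *)

Section TwistedRoots.
Import all_fingroup.

(* The maps x |-> x * h, h in D, and x |-> x ^ g generate a finite group of
   permutations of D in which the first ones form a normal subgroup isomorphic to D. *)
Lemma card_dvd_twisted_roots (G : groupType) (D : set G) (g : G) (n : nat) :
  (0 < n)%N -> subgroup D -> (forall h, D h -> D (h ^ g)) ->
  (forall h, D h -> commute h (g ^+ n)) -> card_dvd D `I_n ->
  card_dvd D [set h | D h /\ (h * g) ^+ n = g ^+ n].
Proof.
move=> n0 sD Dg cDg dvDn; have D1 := subgroup1 sD.
have Dn0 : D !=set0 by exists 1.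
have In0 : `I_n !=set0 by exists 0%N.
have [d Dd] := card_dvd_finite Dn0 In0 dvDn (finite_II n).
have d0 : (0 < d)%N.
  rewrite lt0n; apply/eqP => d0; move: Dd; rewrite d0 II0 card_eq0 => /eqP D0.
  by rewrite D0 in D1.
have [f [fD fI fS]] := card_eq_ex 1 (card_esym Dd).
pose T := 'I_d; pose F (i : T) : G := f i.
have FD i : D (F i) by apply: fD; exact: ltn_ord.
have FI : injective F.
  by move=> i j /fI /= E; apply/val_inj/E; apply: mem_set; exact: ltn_ord.
have FS h : D h -> exists i, F i = h.
  by move=> /fS[i /= ltid <-]; exists (Ordinal ltid).
have permF (phi : G -> G) : (forall h, D h -> D (phi h)) -> injective phi ->
    exists p : {perm T}, forall i, F (p i) = phi (F i).
  move=> phiD phiI.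
  have /choice[q qE] : forall i, exists j, F j = phi (F i).
    by move=> i; apply: FS; exact: phiD.
  have qI : injective q by move=> i j /(congr1 F); rewrite !qE => /phiI/FI.
  by exists (perm qI) => i; rewrite permE.
have /choice[R RE] : forall j, exists p : {perm T}, forall i, F (p i) = F i * F j.
  move=> j; apply: (permF (fun h => h * F j)) => [h Dh|]; first exact: (subgroupM sD).
  exact: mulIg.
have [s sE] := permF _ Dg (@conjg_inj G g).
have RI : injective R.
  move=> j k E; apply: FI; apply: (mulgI (F j)).
  by rewrite -!RE E.
pose L := [set R j | j : T]%SET.
have gL : group_set L.
  apply/group_setP; split.
    have [i1 Fi1] := FS 1 D1; apply/imsetP; exists i1 => //.
    by apply/permP => i; apply: FI; rewrite RE Fi1 mulg1 perm1.
  move=> _ _ /imsetP[j _ ->] /imsetP[k _ ->].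
  have [l Fl] := FS (F j * F k) (subgroupM sD (FD j) (FD k)).
  apply/imsetP; exists l => //; apply/permP => i; apply: FI.
  by rewrite permM !RE Fl mulgA.
have nLs : s \in 'N(Group gL).
  rewrite inE; apply/fintype.subsetP=> _ /imsetP[_ /imsetP[j _ ->] ->].
  have [k Fk] := FS _ (Dg _ (FD j)); apply/imsetP; exists k => //.
  apply/permP=> i; apply: FI; rewrite RE Fk -{2}[i](permKV s).
  by rewrite conjgE !permM sE RE conjMg -sE.
(* [R j * s] acts as [x |-> g^-1 * x * F j * g]. As [g ^+ n] commutes with [D], its [n]-th power is
   trivial exactly when [(F j * g) ^+ n = g ^+ n], as is seen at [x = 1]. *)
have RsE m j i : F (((R j * s) ^+ m : {perm T}) i) = g ^- m * F i * (F j * g) ^+ m.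
  elim: m i => [|m IHm] i.
    by rewrite !expg0 perm1 invg1 mul1g mulg1.
  rewrite expgSr permM permM sE RE IHm !conjgE.
  by rewrite (expgSr (F j * g)) (expgSr g) invgM !mulgA.
have cardL : #|L| = d by rewrite card_imset // card_ord.
have dvdn : (d %| n)%N by apply/(card_dvd_II n d0); apply: card_dvd_eql dvDn.
pose J := [set j : T | (F j * g) ^+ n == g ^+ n]%SET.
have cardJ : #|J| = #|[set y in L :* s | y ^+ n == 1]%SET|.
  rewrite -(card_imset J (f := fun j => R j * s)%g); last first.
    by move=> j k /mulIg /RI.
  apply: eq_card => y; apply/imsetP/idP.
    move=> [j Jj ->]; rewrite inE mem_rcoset mulgK; apply/andP; split.
      by apply/imsetP; exists j.
    apply/eqP/permP => i; apply: FI; rewrite RsE perm1.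
    move: Jj; rewrite inE => /eqP->.
    by rewrite -mulgA (cDg _ (FD i)) mulKg.
  rewrite inE => /andP[/rcosetP[_ /imsetP[j _ ->] ->] /eqP yn].
  exists j => //; have [i1 Fi1] := FS 1 D1.
  have := RsE n j i1; rewrite yn perm1 Fi1 mulg1 => E.
  by rewrite inE -(inj_eq (mulgI (g ^- n))) -E mulVg.
have SJ : [set h | D h /\ (h * g) ^+ n = g ^+ n] = F @` [set` J].
  apply/seteqP; split=> [h [/FS[i <-] E]|_ [j /= Jj <-]].
    by exists i => //=; rewrite inE E.
  by split; [exact: FD | apply/eqP; move: Jj; rewrite inE].
rewrite SJ; apply: card_dvd_eqr (card_esym (card_finset_image J FI)) _.
apply: (card_dvd_eql _ (card_esym Dd)); first by exists 0%N.
apply/card_dvd_II => //; rewrite cardJ -{1}cardL.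
by apply: (@dvdn_card_coset_roots _ (Group gL) s n nLs); rewrite /= cardL.
Qed.
End TwistedRoots.

(** * Twists of homomorphisms *)

Section IntegerPowers.
Variable G : groupType.
Implicit Types (x y : G) (i j : int).

Definition zexpg x i := if i is Negz n then x ^- n.+1 else x ^+ `|i|%N.

Lemma zexpg1 x : zexpg x 1 = x. Proof. by []. Qed.
Lemma zexpg_nat x (n : nat) : zexpg x n = x ^+ n. Proof. by []. Qed.

Lemma zexpgS x i : zexpg x (i + 1)%R = zexpg x i * x.
Proof.
case: i => [n|[|n]].
- by rewrite -PoszD addn1 /zexpg expgSr.
- by rewrite /= mulVg.
- have -> : (Negz n.+1 + 1)%R = Negz n by rewrite !NegzE -(addn1 n.+1) PoszD GRing.opprD GRing.addrNK.
  by rewrite /= [x ^+ n.+2]expgS invgM mulgVK.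
Qed.

Lemma zexpgB1 x i : zexpg x (i - 1)%R = zexpg x i * x^-1.
Proof. by rewrite -{2}(GRing.subrK 1%R i) zexpgS mulgK. Qed.

Lemma zexpgD x i j : zexpg x (i + j)%R = zexpg x i * zexpg x j.
Proof.
elim/int_rect: j => [|n IHn|n IHn].
- by rewrite GRing.addr0 mulg1.
- by rewrite -addn1 PoszD GRing.addrA !zexpgS IHn mulgA.
- by rewrite -addn1 PoszD GRing.opprD GRing.addrA !zexpgB1 IHn mulgA.
Qed.

Lemma zexpgN x i : zexpg x (- i)%R = (zexpg x i)^-1.
Proof. by apply: (mulgI (zexpg x i)); rewrite -zexpgD GRing.subrr mulgV. Qed.

Lemma zexpgB x i j : zexpg x (i - j)%R = zexpg x i * (zexpg x j)^-1.
Proof. by rewrite zexpgD zexpgN. Qed.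

Lemma zexpgM x i j : zexpg x (i * j)%R = zexpg (zexpg x i) j.
Proof.
elim/int_rect: j => [|n IHn|n IHn].
- by rewrite GRing.mulr0.
- by rewrite -addn1 PoszD GRing.mulrDr GRing.mulr1 zexpgS zexpgD IHn.
- by rewrite -addn1 PoszD GRing.opprD GRing.mulrBr GRing.mulr1 zexpgB1 zexpgB IHn.
Qed.

Lemma subgroup_zexpg (A : set G) x i : subgroup A -> A x -> A (zexpg x i).
Proof.
move=> sA Ax; elim/int_rect: i => [|n IHn|n IHn].
- exact: subgroup1 sA.
- by rewrite -addn1 PoszD zexpgS; exact: subgroupM.
- rewrite -addn1 PoszD GRing.opprD zexpgB1.
  by apply: (subgroupM sA IHn); exact: subgroupV.
Qed.

Lemma subgroup_expg (A : set G) x (n : nat) : subgroup A -> A x -> A (x ^+ n).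
Proof. exact: (@subgroup_zexpg A x n). Qed.

Lemma zexpgMn x y i : commute x y -> zexpg (x * y) i = zexpg x i * zexpg y i.
Proof.
move=> cxy; have cxi k : commute x (zexpg y k).
  by case: k => n /=; [|apply: commuteV]; apply: commuteX.
elim/int_rect: i => [|n IHn|n IHn].
- by rewrite mulg1.
- rewrite -addn1 PoszD !zexpgS IHn -!mulgA; congr (_ * _).
  by rewrite mulgA -cxi mulgA.
- rewrite -addn1 PoszD GRing.opprD !zexpgB1 IHn invgM -!mulgA; congr (_ * _).
  by rewrite mulgA; exact: commuteV (commute_sym (commuteM (cxi _) (commuteV cxy))).
Qed.
End IntegerPowers.

Lemma subgroupJ (G : groupType) (A : set G) x y : subgroup A -> A x -> A y -> A (x ^ y).
Proof.
move=> sA Ax Ay; rewrite conjgE; apply: (subgroupM sA); first exact: subgroupV.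
exact: subgroupM.
Qed.

Section Morphisms.
Variables (F G : groupType) (f : F -> G).
Hypothesis hf : monoid_morphism f.

Lemma hom1 : f 1 = 1. Proof. by case: hf. Qed.
Lemma homM x y : f (x * y) = f x * f y. Proof. by case: hf => _; apply. Qed.
Lemma homV x : f x^-1 = (f x)^-1.
Proof. by apply: (mulgI (f x)); rewrite -homM !mulgV hom1. Qed.
Lemma homJ x y : f (x ^ y) = f x ^ f y.
Proof. by rewrite !conjgE !homM homV. Qed.
Lemma homR x y : f [~ x, y] = [~ f x, f y].
Proof. by rewrite !commgEl homM homV homJ. Qed.
Lemma homX x n : f (x ^+ n) = f x ^+ n.
Proof. by elim: n => [|n IHn]; rewrite ?hom1 // !expgS homM IHn. Qed.
Lemma homZ x i : f (zexpg x i) = zexpg (f x) i.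
Proof. by case: i => n /=; rewrite ?homV homX. Qed.
End Morphisms.

(** * Twists along a cyclic quotient [F / K] *)

Section Twists.
Variables (F G : groupType) (K : set F) (t : F) (n : nat).
Hypothesis nK : normal_subgroup K.
Hypothesis genK : forall f, exists i : int, K (f * (zexpg t i)^-1).
Hypothesis ordK : forall i : int, K (zexpg t i) -> exists q : int, i = (n%:Z * q)%R.
Hypothesis tnK : K (t ^+ n).

Let sK : subgroup K := nK.1.

(** The element [k * t^i], with [k] in [K], is sent to [phi k * y^i]. This is well defined because
    possible exponents [i] differ by multiples of [n] and [y ^+ n = phi (t ^+ n)], and
    multiplicative because [y] acts on [phi K] as [t] acts on [K]. *)
Lemma hom_extension (phi : F -> G) (y : G) : monoid_morphism phi ->
  (forall k, K k -> phi k ^ y = phi (k ^ t)) -> y ^+ n = phi (t ^+ n) ->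
  exists psi : F -> G,
    [/\ monoid_morphism psi, forall k, K k -> psi k = phi k & psi t = y].
Proof.
move=> hphi phiy yn.
have KJ k i : K k -> K (k ^ zexpg t i) by exact: nK.2.
have phiJ i k : K k -> phi k ^ zexpg y i = phi (k ^ zexpg t i).
  elim/int_rect: i k => [|m IHm|m IHm] k Kk.
  - by rewrite !conjg1.
  - by rewrite -addn1 PoszD !zexpgS !conjgM IHm // phiy //; exact: KJ.
  - rewrite -addn1 PoszD GRing.opprD !zexpgB1 !conjgM IHm //.
    have {1}-> : k ^ zexpg t (- m%:Z)%R = ((k ^ zexpg t (- m%:Z)%R) ^ t^-1) ^ t by rewrite conjgKV.
    by rewrite -phiy ?conjgK //; apply: nK.2; exact: KJ.
have /choice[d dP] := genK.
pose psi f := phi (f * (zexpg t (d f))^-1) * zexpg y (d f).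
have psiE k i : K k -> psi (k * zexpg t i) = phi k * zexpg y i.
  move=> Kk; rewrite /psi; set j := d _; set k' := _ * _^-1.
  have Kk' : K k' by exact: dP.
  have E : k * zexpg t i = k' * zexpg t j by rewrite mulgVK.
  have E2 : k'^-1 * k = zexpg t (j - i)%R.
    by rewrite zexpgB; apply: (mulIg (zexpg t i)); rewrite mulgVK -mulgA E mulKg.
  have [q jiq] : exists q, (j - i = n%:Z * q)%R.
    by apply: ordK; rewrite -E2; apply: (subgroupM sK) => //; exact: (subgroupV sK).
  have -> : zexpg y j = zexpg y (j - i)%R * zexpg y i by rewrite -zexpgD GRing.subrK.
  rewrite mulgA; congr (_ * _).
  rewrite jiq zexpgM zexpg_nat yn -(homZ hphi) -zexpg_nat -zexpgM -jiq -E2.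
  by rewrite -(homM hphi) mulgA mulgV mul1g.
have decomp f : exists k i, K k /\ f = k * zexpg t i.
  by exists (f * (zexpg t (d f))^-1), (d f); split; [exact: dP | rewrite mulgVK].
exists psi; split.
- split=> [|f f'].
    by have := psiE 1 0%R (subgroup1 sK); rewrite mulg1 (hom1 hphi) mulg1.
  have [k [i [Kk ->]]] := decomp f; have [k' [i' [Kk' ->]]] := decomp f'.
  have Kk2 : K (k' ^ zexpg t (- i)%R) by exact: KJ.
  have -> : k * zexpg t i * (k' * zexpg t i') = (k * k' ^ zexpg t (- i)%R) * zexpg t (i + i')%R.
    by rewrite conjgE zexpgN invgK zexpgD !mulgA mulgVK.
  rewrite !psiE //; last exact: subgroupM.
  by rewrite (homM hphi) -phiJ // conjgE zexpgN invgK zexpgD !mulgA mulgVK.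
- by move=> k Kk; have := psiE k 0%R Kk; rewrite !mulg1.
- by have := psiE 1 1%R (subgroup1 sK); rewrite !zexpg1 mul1g (hom1 hphi) mul1g.
Qed.

Variable H : set G.
Hypothesis sH : subgroup H.

(** For a homomorphism [phi], the largest subgroup of [H] that centralises [phi K] and is normalised
    by the image of [phi]. *)
Definition twist_core (phi : F -> G) : set G :=
  [set h | [/\ H h, forall k, K k -> commute h (phi k) & forall f, H (h ^ phi f)]].

Definition twists (phi : F -> G) : set (F -> G) :=
  [set psi | [/\ monoid_morphism psi, forall k, K k -> psi k = phi k &
              forall f, twist_core phi (psi f * (phi f)^-1)]].

Lemma subgroup_twist_core phi : subgroup (twist_core phi).
Proof.
apply/subgroupP; split=> [|x y [Hx cx Jx] [Hy cy Jy]].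
  split=> [|k _|f]; rewrite ?conj1g; [exact: subgroup1|exact/commute_sym/commute1|exact: subgroup1].
split.
- by apply: (subgroupM sH Hx); exact: subgroupV.
- move=> k Kk; apply/commute_sym/commuteM; first exact/commute_sym/cx.
  by apply/commuteV/commute_sym/cy.
- move=> f; rewrite conjMg conjVg; apply: (subgroupM sH); first exact: Jx.
  by apply: (subgroupV sH); exact: Jy.
Qed.

Lemma twist_coreJ phi h f :
  monoid_morphism phi -> twist_core phi h -> twist_core phi (h ^ phi f).
Proof.
move=> hphi [Hh ch Jh]; split=> [|k Kk|f']; first exact: Jh.
  have -> : phi k = phi (k ^ f^-1) ^ phi f by rewrite -(homJ hphi) conjgKV.
  by rewrite /commute -!conjMg ch //; exact: nK.2.
by rewrite -conjgM -(homM hphi); exact: Jh.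
Qed.

(** On [K] the two maps agree, and [(psi f)^-1 * phi f] lies in [H], so that a conjugate by [phi f]
    is in [H] exactly when the conjugate by [psi f] is. *)
Lemma twist_core_twist phi psi : monoid_morphism phi -> twists phi psi ->
  twist_core psi = twist_core phi.
Proof.
move=> hphi [hpsi eqK psiphi].
have He f : H ((psi f)^-1 * phi f).
  by have [+ _ _] := psiphi f^-1; rewrite (homV hphi) (homV hpsi) invgK.
apply/seteqP; split=> h [Hh ch Jh]; split=> //.
- by move=> k Kk; rewrite -eqK //; exact: ch.
- move=> f; have -> : phi f = psi f * ((psi f)^-1 * phi f) by rewrite mulVKg.
  by rewrite conjgM; exact: (subgroupJ sH).
- by move=> k Kk; rewrite eqK //; exact: ch.
- move=> f; have -> : psi f = phi f * ((psi f)^-1 * phi f)^-1 by rewrite invgM invgK mulVKg.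
  by rewrite conjgM; apply: (subgroupJ sH) => //; exact: subgroupV.
Qed.

Lemma twists_refl phi : monoid_morphism phi -> twists phi phi.
Proof.
by move=> hphi; split=> // f; rewrite mulgV; exact: subgroup1 (subgroup_twist_core phi).
Qed.

(** Equality of the two cores makes twisting symmetric and transitive. *)
Lemma twists_eq phi psi : monoid_morphism phi -> twists phi psi -> twists psi = twists phi.
Proof.
move=> hphi Tpsi; have coreE := twist_core_twist hphi Tpsi.
have sD := subgroup_twist_core phi; have [hpsi eqK psiphi] := Tpsi.
apply/seteqP; split=> theta [htheta eqtK thpsi]; split=> //.
- by move=> k Kk; rewrite eqtK // eqK.
- move=> f; rewrite -(mulgVK (psi f) (theta f)) -mulgA.
  by apply: (subgroupM sD) => //; rewrite -coreE.
- by move=> k Kk; rewrite eqtK // eqK.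
- move=> f; rewrite coreE -(mulgVK (phi f) (theta f)) -mulgA.
  by apply: (subgroupM sD) => //; rewrite -[phi f]invgK -invgM; exact: (subgroupV sD).
Qed.

Definition conjf (phi : F -> G) (c : G) : F -> G := fun f => phi f ^ c.

Lemma conjfM phi c d : conjf phi (c * d) = conjf (conjf phi c) d.
Proof. by apply/funext => f; rewrite /conjf conjgM. Qed.

Lemma conjfK phi c : conjf (conjf phi c) c^-1 = phi.
Proof. by apply/funext => f; rewrite /conjf conjgK. Qed.

Lemma conjfKV phi c : conjf (conjf phi c^-1) c = phi.
Proof. by apply/funext => f; rewrite /conjf conjgKV. Qed.

Lemma hom_conjf phi c : monoid_morphism phi -> monoid_morphism (conjf phi c).
Proof.
move=> hphi; split=> [|x y]; first by rewrite /conjf (hom1 hphi) conj1g.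
by rewrite /conjf (homM hphi) conjMg.
Qed.

Lemma twist_core_conjf phi c h : H c -> twist_core phi h -> twist_core (conjf phi c) (h ^ c).
Proof.
move=> Hc [Hh ch Jh]; split; first exact: subgroupJ.
- by move=> k Kk; rewrite /conjf /commute -!conjMg ch.
- by move=> f; rewrite /conjf -conjJg; exact: subgroupJ.
Qed.

Lemma twists_conjf phi psi c : H c -> twists phi psi -> twists (conjf phi c) (conjf psi c).
Proof.
move=> Hc [hpsi eqK Dpsi]; split; first exact: hom_conjf.
- by move=> k Kk; rewrite /conjf eqK.
- by move=> f; rewrite /conjf -conjVg -conjMg; exact: twist_core_conjf.
Qed.

(** Conjugation by [c] fixes [phi] on [K] exactly when [c] centralises [phi K]. At [f^-1] the
    quotient of the conjugate by [phi] is [c^-1 * c ^ phi f], which relates the other condition to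
    the conjugates of [c]. *)
Lemma twists_conjf_core phi c : monoid_morphism phi -> H c ->
  twists phi (conjf phi c) <-> twist_core phi c.
Proof.
move=> hphi Hc; split=> [[_ eqK Dc]|Dc].
  split=> // [k Kk|f].
    have := eqK k Kk; rewrite /conjf conjgE => E.
    by rewrite /commute -{1}E mulVKg.
  have [+ _ _] := Dc f^-1; rewrite /conjf (homV hphi) invgK conjgE => E.
  have -> : c ^ phi f = c * (c^-1 * ((phi f)^-1 * c) * phi f) by rewrite conjgE !mulgA mulgV mul1g.
  exact: subgroupM.
split; first exact: hom_conjf.
- by move=> k Kk; have [_ ch _] := Dc; rewrite /conjf conjgE -(ch k Kk) mulKg.
- move=> f; have sD := subgroup_twist_core phi.
  have -> : conjf phi c f * (phi f)^-1 = c^-1 * (c ^ phi f^-1).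
    by rewrite /conjf (homV hphi) !conjgE invgK !mulgA.
  by apply: (subgroupM sD); [exact: (subgroupV sD) | exact: twist_coreJ].
Qed.

(** A twist is determined by its value at [t], and [hom_extension] realises every value that [S]
    allows. *)
Lemma card_dvd_twists phi : monoid_morphism phi -> card_dvd H `I_n ->
  card_dvd (twist_core phi) (twists phi).
Proof.
move=> hphi dvHn; set D := twist_core phi; have sD : subgroup D := subgroup_twist_core phi.
have sDH : D `<=` H by move=> h [].
set g := phi t; pose S := [set h | D h /\ (h * g) ^+ n = g ^+ n].
have cDg h : D h -> commute h (g ^+ n).
  by move=> [_ ch _]; rewrite /g -(homX hphi); exact: ch.
have dvDS : card_dvd D S.
  (* For [n = 0] the equation in [S] is vacuous and [S] is [D]. *)
  have [n0|n0] := posnP n.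
    have -> : S = D by apply/seteqP; split=> [h []|h Dh] //; split=> //; rewrite n0.
    exact: card_dvd_subgroup.
  apply: card_dvd_twisted_roots => // [h Dh|]; first exact: twist_coreJ.
  apply: (card_dvd_trans _ _ (card_dvd_subgroup sD sDH sH) dvHn); exists 1; exact: subgroup1.
suff ST : S = (fun psi => psi t * g^-1) @` twists phi.
  apply: card_dvd_eqr dvDS; rewrite ST; apply: inj_card_eq => psi psi'.
  rewrite !inE => -[hpsi eqK _] [hpsi' eqK' _] /mulIg E; apply/funext => f.
  have [i Kf] := genK f; rewrite -(mulgVK (zexpg t i) f).
  by rewrite (homM hpsi) (homM hpsi') eqK // eqK' // (homZ hpsi) (homZ hpsi') E.
apply/seteqP; split=> [h [Dh hgn]|_ [psi [hpsi eqK Dpsi] <-]]; last first.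
  split; first exact: Dpsi.
  by rewrite mulgVK -(homX hpsi) eqK // (homX hphi).
have [||psi [hpsi eqK psit]] := @hom_extension phi (h * g) hphi.
- move=> k Kk; have [_ ch _] := Dh; rewrite conjgM (homJ hphi); congr (_ ^ _).
  by rewrite conjgE -(ch k Kk) mulKg.
- by rewrite hgn (homX hphi).
exists psi; last by rewrite psit mulgK.
(* The elements at which the twist condition holds form a subgroup containing [K] and [t], hence all
   of [F]. *)
split=> //; pose P := [set f | D (psi f * (phi f)^-1)].
have PM f f' : P f -> P f' -> P (f * f').
  move=> Pf Pf'; rewrite /P /= (homM hphi) (homM hpsi).
  have -> : psi f * psi f' * (phi f * phi f')^-1 =
            psi f * (phi f)^-1 * (psi f' * (phi f')^-1) ^ phi f^-1.
    by rewrite (homV hphi) conjgE invgK invgM !mulgA mulgVK.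
  by apply: (subgroupM sD Pf); exact: twist_coreJ.
have PV f : P f -> P f^-1.
  move=> Pf; rewrite /P /= (homV hphi) (homV hpsi) invgK.
  have -> : (psi f)^-1 * phi f = (psi f * (phi f)^-1)^-1 ^ phi f.
    by rewrite conjgE invgM invgK !mulgA mulVg mul1g.
  by apply: twist_coreJ => //; exact: (subgroupV sD).
have sP : subgroup P.
  apply/subgroupP; split=> [|f f' Pf Pf']; last by apply: PM => //; exact: PV.
  by rewrite /P /= (hom1 hpsi) (hom1 hphi) mulgV; exact: (subgroup1 sD).
move=> f; suff : P f by []; have [i Kf] := genK f; rewrite -(mulgVK (zexpg t i) f).
apply: PM; first by rewrite /P /= eqK // mulgV; exact: (subgroup1 sD).
by apply: (subgroup_zexpg _ sP); rewrite /P /= psit -/g mulgK.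
Qed.

(* The H-saturation of a twist class is in bijection with the product of the set of
   cosets of twist_core in H by the class; s picks the coset of psi. *)
Lemma card_dvd_twist_orbit phi : monoid_morphism phi -> card_dvd H `I_n ->
  card_dvd H [set psi | exists2 c, H c & twists phi (conjf psi c)].
Proof.
move=> hphi dvHn; set D := twist_core phi; have sD : subgroup D := subgroup_twist_core phi.
have sDH : D `<=` H by move=> h [].
have [a [c [aD inj sur]]] := card_dvd_elim (subgroup1 sD) (card_dvd_twists hphi dvHn).
pose X psi := [set h | H h /\ twists phi (conjf psi h)].
pose s psi := xget 1 (X psi).
(* A nonempty [X psi] is a left coset of [D]; since [xget] depends only on the set, [s psi] is a
   canonical representative of it. *)
have XE psi h : X psi h -> X psi = [set x | D (h^-1 * x)].
  move=> [Hh Th]; have htheta : monoid_morphism (conjf psi h) by case: Th.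
  have TE := twists_eq hphi Th; have DE := twist_core_twist hphi Th.
  apply/seteqP; split=> x /=.
    move=> [Hx Tx]; rewrite /D -DE; apply/twists_conjf_core => //.
      by apply: (subgroupM sH) => //; exact: subgroupV.
    by rewrite TE -conjfM mulVKg.
  rewrite /D -DE => Dx; have Hx : H (h^-1 * x) by apply: sDH; rewrite /D -DE.
  split; first by rewrite -(mulVKg h x); exact: subgroupM.
  by move/(twists_conjf_core htheta Hx): Dx; rewrite TE -conjfM mulVKg.
have sX psi h : X psi h -> X psi (s psi) by move=> Xh; apply: xgetPex; exists h.
apply: (card_dvd_intro (a := fun psi => a (conjf psi (s psi)) * (s psi)^-1)
                       (c := fun psi => c (conjf psi (s psi)))).
- move=> psi [h Hh Th]; have [Hs Ts] := sX psi h (conj Hh Th).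
  by apply: (subgroupM sH); [apply/sDH/aD | exact: subgroupV].
- move=> psi psi' [h Hh Th] [h' Hh' Th'] aE cE.
  have Xs := sX psi h (conj Hh Th); have Xs' := sX psi' h' (conj Hh' Th').
  (* Equal first coordinates put [s psi] and [s psi'] in one left coset of [D], so the chosen
     representatives coincide. *)
  have sE : s psi' = s psi.
    rewrite /s (XE _ _ Xs) (XE _ _ Xs'); congr xget.
    have dE : (s psi')^-1 = (a (conjf psi' (s psi')))^-1 * a (conjf psi (s psi)) * (s psi)^-1.
      by rewrite -mulgA aE mulKg.
    have Da := aD _ Xs.2; have Da' := aD _ Xs'.2.
    apply/seteqP; split=> x /=; last first.
      by rewrite dE -mulgA => Dx; apply: (subgroupM sD) => //; apply: (subgroupM sD) => //; exact: (subgroupV sD).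
    have -> : (s psi)^-1 = ((a (conjf psi' (s psi')))^-1 * a (conjf psi (s psi)))^-1 * (s psi')^-1.
      by rewrite dE mulKg.
    rewrite -mulgA => Dx; apply: (subgroupM sD) => //; apply: (subgroupV sD).
    by apply: (subgroupM sD) => //; exact: (subgroupV sD).
  have : conjf psi (s psi) = conjf psi' (s psi').
    apply: inj => //; [exact: Xs.2 | exact: Xs'.2 |].
    by move: aE; rewrite sE => /mulIg.
  by rewrite sE => /(congr1 (conjf^~ (s psi)^-1)); rewrite !conjfK.
- move=> x psi Hx [h Hh Th]; have Xs := sX psi h (conj Hh Th).
  (* First coordinate [x] forces the representative into the coset [x^-1 D]; with [s'] chosen there,
     the coordinate in [D] has to be [x * s']. *)
  pose s' := xget 1 [set y | D (x * y)].
  have Ds' : D (x * s').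
    apply: (@xgetPex _ 1 [set y | D (x * y)]); exists x^-1; rewrite /= mulgV; exact: (subgroup1 sD).
  have Hs' : H s' by rewrite -(mulKg x s'); apply: (subgroupM sH); [exact: subgroupV | exact: sDH].
  have [theta [Ttheta atheta ctheta]] := sur _ _ Ds' Xs.2.
  exists (conjf theta s'^-1).
  have Xs2 : X (conjf theta s'^-1) s' by split=> //; rewrite conjfKV.
  have sE : s (conjf theta s'^-1) = s'.
    rewrite /s (XE _ _ Xs2) /s'; congr xget; apply/seteqP; split=> y /=.
      by move=> Dy; have := subgroupM sD Ds' Dy; rewrite mulgA mulgK.
    move=> Dy; have := subgroupM sD (subgroupV sD Ds') Dy.
    by rewrite invgM -mulgA mulKg.
  rewrite sE conjfKV; split=> //; last by rewrite atheta mulgK.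
  by exists s' => //; rewrite conjfKV.
Qed.

(** Conjugation by [H] carries twists to twists, so the two operations together define an
    equivalence relation on [Phi]. As [Phi] is closed under both, each class is a full set as in
    [card_dvd_twist_orbit]. *)
Theorem card_dvd_homs (Phi : set (F -> G)) :
  (forall phi, Phi phi -> monoid_morphism phi) ->
  (forall phi c, Phi phi -> H c -> Phi (conjf phi c)) ->
  (forall phi psi, Phi phi -> twists phi psi -> Phi psi) ->
  card_dvd H `I_n -> card_dvd H Phi.
Proof.
move=> PhiM PhiJ PhiT dvHn.
pose R phi psi := exists2 c, H c & twists phi (conjf psi c).
have RH phi psi c : Phi phi -> H c -> twists phi (conjf psi c) -> Phi psi.
  by move=> Pphi Hc Tc; rewrite -(conjfK psi c); apply: PhiJ; [exact: PhiT Tc | exact: subgroupV].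
have Rsub x y : Phi x -> R x y -> forall z, R y z -> R x z.
  move=> Px [c Hc Tc] z [d Hd Td]; exists (d * c); first exact: subgroupM.
  by rewrite conjfM -(twists_eq (PhiM _ Px) Tc); exact: twists_conjf.
apply: (card_dvd_partition (R := R)).
- by exists 1; exact: subgroup1.
- move=> phi Pphi; exists 1; first exact: subgroup1.
  have -> : conjf phi 1 = phi by apply/funext => f; rewrite /conjf conjg1.
  exact/twists_refl/PhiM.
- move=> x y Px Py Rxy.
  have Ryx : R y x.
    have [c Hc Tc] := Rxy; exists c^-1; first exact: subgroupV.
    have := twists_refl (PhiM _ Px); rewrite -(twists_eq (PhiM _ Px) Tc) => T.
    by have := twists_conjf (subgroupV sH Hc) T; rewrite conjfK.
  by apply/seteqP; split=> z [Pz Rz]; split=> //; [exact: Rsub Ryx _ Rz | exact: Rsub Rxy _ Rz].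
- move=> phi Pphi.
  have -> : [set z | Phi z /\ R phi z] = [set psi | exists2 c, H c & twists phi (conjf psi c)].
    by apply/seteqP; split=> z [] //; move=> c Hc Tc; split; [exact: RH Tc | exists c].
  by apply: card_dvd_twist_orbit => //; exact: PhiM.
Qed.
End Twists.

(** * Cyclic quotients of finitely generated abelian groups *)

(** The default value 0 fits the pattern: if no positive power kills [X], the only [k] that does is
    0, and 0 divides 0. *)
Lemma exponentP (X : groupType) :
  (forall x : X, x ^+ exponent X = 1) /\
  (forall k, (forall x : X, x ^+ k = 1) -> (exponent X %| k)%N).
Proof.
rewrite /exponent; case: xgetP => [n _ [n0 xn minn]|noexp].
  split=> // k xk; rewrite /dvdn; apply: contrapT => /negP; rewrite -lt0n => r0.
  have := minn _ r0; rewrite leqNgt ltn_mod n0 => /(_ _)/negP; apply; last by [].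
  move=> x; have := xk x; rewrite {1}(divn_eq k n) expgnDr mulnC expgnA xn expg1n mul1g.
  by [].
split=> // k xk; have [->//|k0] := posnP k; exfalso.
have exk : exists k, (0 < k)%N && `[< forall x : X, x ^+ k = 1 >].
  by exists k; rewrite k0; apply/asboolP.
have := noexp (ex_minn exk); apply.
case: ex_minnP => n /andP[n0 /asboolP xn] minn; split=> // j j0 xj.
by apply: minn; rewrite j0; apply/asboolP.
Qed.

Lemma expg_gcdn (Q : groupType) (z : Q) a b :
  z ^+ a = 1 -> z ^+ b = 1 -> z ^+ gcdn a b = 1.
Proof.
have [->|a0] := posnP a; first by rewrite gcd0n.
move=> za zb; case: (egcdnP b a0) => km kn E _.
have := congr1 (natexp z) E.
by rewrite expgnDr ![(_ * a)%N]mulnC ![(_ * b)%N]mulnC !expgnA za zb !expg1n mul1g => <-.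
Qed.

(* The product over the primes p dividing m of elements x_p ^+ (m / p^a), where p^a is
   the p-part of m and x_p ^+ (m / p) != 1, has order m. *)
Lemma exponent_witness (Q : groupType) : (forall x y : Q, commute x y) ->
  (0 < exponent Q)%N -> exists t : Q, forall i, t ^+ i = 1 -> (exponent Q %| i)%N.
Proof.
move=> cQ; have [] := exponentP Q; set m := exponent Q => xm minm m0.
(* The second clause keeps the factors apart: [t] has no effect at primes not yet treated. *)
have claim l : uniq l -> {subset l <= primes m} -> exists t : Q,
    (forall p, p \in l -> t ^+ (m %/ p) <> 1) /\
    (forall p, p \in primes m -> p \notin l -> t ^+ (m %/ p) = 1).
  elim: l => [|p l IHl] /=; first by exists 1; split=> // p _ _; rewrite expg1n.
  move=> /andP[npl ul] sl; have [q lq|t [t1 t2]] := IHl ul.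
    by apply: sl; rewrite inE lq orbT.
  have /[!mem_primes]/and3P[p_pr _ pm] : p \in primes m by apply: sl; rewrite inE eqxx.
  have [x xp] : exists x : Q, x ^+ (m %/ p) <> 1.
    apply: contrapT => nx; have : (m %| m %/ p)%N.
      by apply: minm => x; apply: contrapT => xp; apply: nx; exists x.
    move/dvdn_leq; rewrite divn_gt0 ?prime_gt0 // dvdn_leq // => /(_ isT).
    by rewrite leqNgt ltn_Pdiv ?prime_gt1.
  (* The p-part of [m] divides [m %/ q], so the total exponent of [x] is a multiple of [m]. *)
  have y1 q : q \in primes m -> q != p -> (x ^+ m`_p^') ^+ (m %/ q) = 1.
    rewrite mem_primes => /and3P[q_pr _ qm] qp; rewrite -expgnA.
    have /dvdnP[k ->] : (m %| m`_p^' * (m %/ q))%N.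
      rewrite -{1}(partnC p m0) mulnC dvdn_mul //.
      rewrite -(@Gauss_dvdr _ q) ?[(q * _)%N]mulnC ?divnK ?dvdn_part //.
      rewrite (pnat_coprime (part_pnat p m)) //.
      by rewrite pnatE // inE /= inE.
    by rewrite mulnC expgnA xm expg1n.
  exists (t * x ^+ m`_p^'); split=> q.
    rewrite inE => /predU1P[->|lq]; last first.
      rewrite expgMn // y1 ?mulg1; first exact: t1.
        by apply: sl; rewrite inE lq orbT.
      by apply: contraNneq npl => <-.
    rewrite expgMn // t2 ?mul1g ?mem_primes ?p_pr ?m0 // -expgnA mulnC expgnA => z1; apply: xp.
    have zp : (x ^+ (m %/ p)) ^+ p = 1 by rewrite -expgnA divnK.
    have := expg_gcdn z1 zp; suff /eqP-> : coprime m`_p^' p by [].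
    by rewrite coprime_sym (@pnat_coprime p) ?part_pnat ?pnat_id.
  move=> qm; rewrite inE negb_or => /andP[qp nql].
  by rewrite expgMn // t2 // y1 // mulg1.
have [t [tn _]] := claim _ (primes_uniq m) (fun _ h => h).
exists t => i ti; have tg := expg_gcdn ti (xm t).
have gm := dvdn_gcdr i m; suff <- : gcdn i m = m by exact: dvdn_gcdl.
apply/eqP; rewrite eqn_dvd gm /=; apply/negPn/negP => ngm.
have /dvdnP[k mk] := gm.
have k1 : (1 < k)%N.
  case: k mk => [|[|k]] mk //; first by move: m0; rewrite mk.
  by case/negP: ngm; rewrite {1}mk mul1n.
have pk := pdiv_dvd k; have p_pr := pdiv_prime k1.
apply: (tn (pdiv k)).
  by rewrite mem_primes p_pr m0 mk dvdn_mulr.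
have -> : (m %/ pdiv k = gcdn i m * (k %/ pdiv k))%N by rewrite mulnC divn_mulAC // -mk.
by rewrite expgnA tg expg1n.
Qed.

Section CyclicQuotient.
Variable Q : groupType.
Hypothesis cQ : forall x y : Q, commute x y.
Implicit Types (K B : set Q).

Definition adjoin K (x : Q) : set Q := [set y | exists i k, K k /\ y = k * zexpg x i].

Lemma subgroup_adjoin K x : subgroup K -> subgroup (adjoin K x).
Proof.
move=> sK; apply/subgroupP; split; first by exists 0%R, 1; split; [exact: subgroup1 | rewrite mulg1].
move=> _ _ [i [k [Kk ->]]] [j [l [Kl ->]]]; exists (i - j)%R, (k * l^-1); split.
  by apply: (subgroupM sK Kk); exact: subgroupV.
rewrite zexpgB invgM -!mulgA; congr (_ * _); rewrite mulgA.
exact: cQ.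
Qed.

Lemma sub_adjoin K x : K `<=` adjoin K x.
Proof. by move=> k Kk; exists 0%R, k; rewrite mulg1. Qed.

Lemma mem_adjoin K x : subgroup K -> adjoin K x x.
Proof. by move=> sK; exists 1%R, 1; split; [exact: subgroup1 | rewrite mul1g]. Qed.

Lemma Zorn_subgroup (Pr : set Q -> Prop) : Pr [set 1] ->
  (forall C : set (set Q), C !=set0 -> total_on C subset ->
    (forall X, C X -> subgroup X /\ Pr X) -> Pr (\bigcup_(X in C) X)) ->
  exists K, [/\ subgroup K, Pr K & forall B x, subgroup B -> K `<=` B -> B x -> ~ K x -> ~ Pr B].
Proof.
move=> Pr1 PrU; pose P X := X = set0 \/ (subgroup X /\ Pr X).
have [C CP Ctot|K [PK maxK]] := @Zorn_bigcup Q P.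
  have [[X CX [x Xx]]|nC] := pselect (exists2 X, C X & X !=set0); last first.
    left; apply/seteqP; split=> // x [X CX Xx]; apply: nC; exists X => //; by exists x.
  right; pose C' := [set X | C X /\ X !=set0].
  have -> : \bigcup_(X in C) X = \bigcup_(X in C') X.
    apply/seteqP; split=> y [Y CY Yy]; exists Y => //; first by split=> //; exists y.
    by case: CY.
  have C'P Y : C' Y -> subgroup Y /\ Pr Y.
    by move=> [/CP[->|//] [y]].
  have C'tot : total_on C' subset by move=> Y Z [CY _] [CZ _]; exact: Ctot.
  have C'X : C' X by split=> //; exists x.
  split; last by apply: PrU => //; exists X.
  apply/subgroupP; split.
    exists X => //; exact: subgroup1 (C'P X C'X).1.
  move=> y z [Y CY Yy] [Z CZ Zz]; have [YZ|ZY] := C'tot Y Z CY CZ.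
    have [sZ _] := C'P Z CZ; exists Z => //.
    by apply: (subgroupM sZ (YZ y Yy)); exact: subgroupV.
  have [sY _] := C'P Y CY; exists Y => //.
  by apply: (subgroupM sY Yy); apply: subgroupV => //; exact: ZY.
have s1 : subgroup [set 1 : Q].
  by apply/subgroupP; split=> // _ _ -> ->; rewrite /= invg1 mulg1.
have [K0|[sK PrK]] := PK.
  exfalso; apply: (maxK [set 1]); last by right.
  by rewrite K0; split=> // /(_ 1 erefl).
exists K; split=> // B x sB KB Bx nKx PrB; apply: (maxK B); last by right.
by split=> // /(_ x Bx).
Qed.

Let zM (x y : Q) i : zexpg (x * y) i = zexpg x i * zexpg y i.
Proof. by apply: zexpgMn; exact: cQ. Qed.

(** A cyclic subgroup [<t>] whose order is the exponent is a direct factor: [K] is maximal among the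
    subgroups meeting it trivially, and an element outside [K<t>] would yield a larger one. *)
Lemma cyclic_quotient_finite : (0 < exponent Q)%N -> exists K (t : Q),
  [/\ subgroup K, forall x, exists i : int, K (x * (zexpg t i)^-1),
      forall i : int, K (zexpg t i) -> exists q : int, i = ((exponent Q)%:Z * q)%R &
      K (t ^+ exponent Q)].
Proof.
move=> m0; have [t tm] := exponent_witness cQ m0; move: m0 tm.
have [xm _] := exponentP Q; set m := exponent Q in xm * => m0 tm.
pose Pr K := forall i : int, K (zexpg t i) -> (m%:Z %| i)%Z.
have [||K [sK PrK maxK]] := @Zorn_subgroup Pr.
- move=> [i|i] /= ti; rewrite dvdzE /=; first exact: tm.
  by apply: tm; rewrite -[t ^+ _]invgK ti invg1.
- by move=> C _ _ CP i [X CX Xi]; have [_] := CP X CX; apply.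
exists K, t; split=> //; last first.
- by rewrite xm; exact: subgroup1 sK.
- by move=> i /PrK/dvdzP[q ->]; exists q; rewrite GRing.mulrC.
have sB := subgroup_adjoin t sK; set B := adjoin K t in sB.
have KB : K `<=` B by exact: sub_adjoin.
suff BT x : B x.
  by move=> x; have [i [k [Kk ->]]] := BT x; exists i; rewrite mulgK.
apply: contrapT => nBx.
(* The least such [k] is the order of [x] modulo [B]; a suitable power [x1] of [x] has prime order
   [p] modulo [B]. *)
have exk : exists k, (0 < k)%N && `[< B (x ^+ k) >].
  by exists m; rewrite m0 xm; apply/asboolP; exact: subgroup1 sB.
case: (ex_minnP exk) => k0 /andP[k00 /asboolP Bxk] mink.
have k01 : (1 < k0)%N.
  by rewrite ltn_neqAle k00 andbT; apply/eqP => k1; apply: nBx; rewrite -k1 in Bxk.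
have k0m : (k0 %| m)%N.
  rewrite /dvdn; apply: contrapT => /negP; rewrite -lt0n => r0.
  have : (k0 <= m %% k0)%N.
    apply: mink; rewrite r0; apply/asboolP; have := xm x.
    rewrite {1}(divn_eq m k0) expgnDr mulnC expgnA => /mulg1_eq<-; apply: (subgroupV sB); exact: subgroup_expg.
  by rewrite leqNgt ltn_mod k00.
set p := pdiv k0; have p_pr : prime p := pdiv_prime k01.
have pk : (p %| k0)%N := pdiv_dvd k0; have pm := dvdn_trans pk k0m.
set x1 := x ^+ (k0 %/ p).
have nBx1 : ~ B x1.
  move=> Bx1; have : (k0 <= k0 %/ p)%N.
    apply: mink; rewrite divn_gt0 ?prime_gt0 // dvdn_leq //; exact/asboolP.
  by rewrite leqNgt ltn_Pdiv ?prime_gt1.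
have [j [k [Kk x1p]]] : B (x1 ^+ p) by rewrite -expgnA divnK.
(* From [x1 ^+ m = 1] it follows that [m] divides [j * (m %/ p)], so [p] divides [j]. Dividing [x1]
   by [t^j'] then moves its [p]-th power into [K]. *)
have [j' jE] : exists j', j = (p%:Z * j')%R.
  have : K (zexpg t (j * (m %/ p)%N%:Z)%R).
    have : x1 ^+ p ^+ (m %/ p) = 1 by rewrite -expgnA mulnC divnK.
    rewrite x1p -zexpg_nat zM -zexpgM => /mulg1_eq<-; apply: (subgroupV sK); exact: subgroup_zexpg.
  have mE : (m%:Z = p%:Z * (m %/ p)%N%:Z)%R by rewrite -PoszM mulnC divnK.
  move/PrK; rewrite [X in (X %| _)%Z]mE dvdz_mul2r; last first.
    by rewrite eqz_nat -lt0n divn_gt0 ?prime_gt0 // dvdn_leq.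
  by move=> /dvdzP[q ->]; exists q; rewrite GRing.mulrC.
pose x2 := x1 * (zexpg t j')^-1.
have Kx2p : K (x2 ^+ p).
  rewrite -zexpg_nat zM zexpg_nat x1p -zexpgN -zexpgM GRing.mulNr zexpgN jE GRing.mulrC.
  by rewrite mulgK.
have Bt : B t by exact: mem_adjoin.
have nBx2 : ~ B x2.
  move=> Bx2; apply: nBx1; rewrite -(mulgVK (zexpg t j') x1).
  by apply: (subgroupM sB Bx2); exact: subgroup_zexpg.
apply: (maxK (adjoin K x2) x2); [exact: subgroup_adjoin|exact: sub_adjoin|exact: mem_adjoin| |].
  by move=> /KB.
move=> i [l [k' [Kk' tiE]]].
have [/dvdzP[q lE]|npl] := boolP (p%:Z %| l)%Z.
  apply: PrK; rewrite tiE; apply: (subgroupM sK Kk').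
  by rewrite lE GRing.mulrC zexpgM; exact: subgroup_zexpg.
(* If [l] is prime to [p], the elements [x2^p] and [x2^l] of [B] generate [x2]. *)
case: nBx2; have [u [v uv]] := Bezoutz p l.
have pl1 : gcdz p l = 1%R.
  by move: npl; rewrite dvdzE /= -prime_coprime // => /eqP E; rewrite /gcdz /= E.
rewrite -(zexpg1 x2) -pl1 -uv zexpgD; apply: (subgroupM sB).
  by rewrite GRing.mulrC zexpgM; apply: (subgroup_zexpg _ sB); exact: KB.
rewrite GRing.mulrC zexpgM; apply: (subgroup_zexpg _ sB).
rewrite -(mulKg k' (zexpg x2 l)) -tiE; apply: (subgroupM sB).
  by apply: (subgroupV sB); exact: KB.
exact: subgroup_zexpg.
Qed.

Hypothesis fgQ : finitely_generated Q.

(** [K] is maximal among the subgroups whose quotient has infinite period. Then [Q / K] is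
    torsion-free and every larger subgroup has a quotient of finite period, so some [e]-th power map
    embeds [Q / K] into an infinite cyclic group. *)
Lemma cyclic_quotient_infinite : exponent Q = 0%N -> exists K (t : Q),
  [/\ subgroup K, forall x, exists i : int, K (x * (zexpg t i)^-1) &
      forall i : int, K (zexpg t i) -> i = 0%R].
Proof.
move=> m0; have [_ minm] := exponentP Q; rewrite m0 in minm.
pose Pr K := forall k, (forall x, K (x ^+ k)) -> k = 0%N.
have [||K [sK PrK maxK]] := @Zorn_subgroup Pr.
- by move=> k xk; apply/eqP; rewrite -dvd0n; exact: minm.
- move=> C [X0 CX0] Ctot CP k Uk.
  have [S [s Ss] gS] : exists2 S : set Q, (exists s : seq Q, S = [set` s]) & generated S = [set: Q].
    by case: fgQ => S /finite_seqP sS gS; exists S.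
  (* Finite generation enters here: the [k]-th powers of finitely many generators lie in one member
     of the chain. *)
  have [X CX Xs] : exists2 X, C X & forall x, x \in s -> X (x ^+ k).
    elim: s {S Ss gS} => [|x s [X CX Xs]]; first by exists X0.
    have [Y CY Yx] := Uk x; have [XY|YX] := Ctot X Y CX CY.
      by exists Y => // y; rewrite inE => /predU1P[->//|/Xs/XY].
    by exists X => // y; rewrite inE => /predU1P[->|/Xs//]; exact: YX.
  have [sX PrX] := CP X CX; apply: PrX => x.
  have gSx : generated S x by rewrite gS.
  apply: (gSx [set y | X (y ^+ k)]); split; last by rewrite Ss => y /= /Xs.
  apply/subgroupP; split=> [|y z Xy Xz]; first by rewrite /= expg1n; exact: subgroup1 sX.
  rewrite /= (expgnFl _ (cQ y z)); apply: (subgroupM sX Xy); exact: subgroupV.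
(* If all [e]-th powers lie in [K<x>], all [(e * d)]-th powers lie in [K], so [e = 0]; thus [K<x>]
   would still be admissible. *)
have torsion_free x d : (0 < d)%N -> K (x ^+ d) -> K x.
  move=> d0 Kxd; apply: contrapT => nKx.
  apply: (maxK (adjoin K x) x _ (@sub_adjoin K x) (mem_adjoin x sK) nKx); first exact: subgroup_adjoin.
  move=> e Be; have : (e * d)%N = 0%N.
    apply: PrK => y; have [i [k [Kk E]]] := Be y.
    rewrite expgnA E -zexpg_nat zM; apply: (subgroupM sK); first exact: subgroup_zexpg.
    by rewrite -zexpgM GRing.mulrC zexpgM; exact: subgroup_zexpg.
  by move/eqP; rewrite muln_eq0 [d == 0%N]gtn_eqF // orbF => /eqP.
have [x nKx] : exists x, ~ K x.
  apply: contrapT => nx; have : 1%N = 0%N by apply: PrK => x; apply: contrapT => nKx; apply: nx; exists x.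
  by [].
have x_inf i : K (zexpg x i) -> i = 0%R.
  case: i => [[|k]|k] //= Kx; case: nKx; apply: (torsion_free _ k.+1) => //.
  by rewrite -[x ^+ _]invgK; exact: subgroupV.
have [e e0 Be] : exists2 e, (0 < e)%N & forall y, adjoin K x (y ^+ e).
  apply: contrapT => ne.
  apply: (maxK (adjoin K x) x _ (@sub_adjoin K x) (mem_adjoin x sK) nKx); first exact: subgroup_adjoin.
  by move=> e Be; apply/eqP; rewrite -leqn0 leqNgt; apply/negP => e0; apply: ne; exists e.
(* For the least such [c], the [e]-th root [t] of [k * x ^+ c] generates [Q] modulo [K]: a nonzero
   remainder of an exponent modulo [c] would be a smaller choice. *)
pose I c := (0 < c)%N && `[< exists y k, K k /\ y ^+ e = k * x ^+ c >].
have exI : exists c, I c.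
  by exists e; rewrite /I e0; apply/asboolP; exists x, 1; rewrite mul1g; split=> //; exact: subgroup1.
case: (ex_minnP exI) => c /andP[c0 /asboolP[t [k [Kk tE]]]] minc.
exists K, t; split=> // [y|i Kti].
  have [i [l [Kl yE]]] := Be y; exists (i %/ c%:Z)%Z; set q := (i %/ c)%Z.
  have rE : (i + c%:Z * - q)%R = (i %% c%:Z)%Z.
    by rewrite {1}(divz_eq i c) -/q GRing.mulrN [(c%:Z * q)%R]GRing.mulrC GRing.addrAC GRing.subrr GRing.add0r.
  have yqE : (y * (zexpg t q)^-1) ^+ e = l * zexpg k (- q)%R * zexpg x (i %% c%:Z)%Z.
    rewrite -zexpg_nat zM -zexpgN -zexpgM zexpg_nat yE GRing.mulrC zexpgM zexpg_nat tE.
    rewrite zM -zexpg_nat -zexpgM -rE zexpgD -!mulgA; congr (_ * _).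
    by rewrite mulgA (cQ (zexpg x i)) mulgA.
  have Kr : K (l * zexpg k (- q)%R) by apply: (subgroupM sK Kl); exact: subgroup_zexpg.
  have c0' : (c%:Z != 0)%R by rewrite eqz_nat -lt0n.
  have := ltz_pmod i (d := Posz c); rewrite ltz_nat => /(_ c0).
  case: (i %% c)%Z (modz_ge0 i c0') yqE => // r _; rewrite ltz_nat zexpg_nat => yqE rc.
  have [r0|r0] := posnP r; first by apply: (torsion_free _ e) => //; rewrite yqE r0 mulg1.
  have : (c <= r)%N.
    by apply: minc; rewrite /I r0; apply/asboolP; exists (y * (zexpg t q)^-1), (l * zexpg k (- q)%R).
  by rewrite leqNgt rc.
have : K (zexpg x (c%:Z * i)%R).
  have : K (zexpg t i ^+ e) by exact: subgroup_expg.
  rewrite -zexpg_nat -(zexpgM t) GRing.mulrC (zexpgM t) zexpg_nat tE zM -zexpg_nat -(zexpgM x) => Kki.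
  rewrite -(mulKg (zexpg k i) (zexpg x _)); apply: (subgroupM sK) Kki.
  by apply: (subgroupV sK); exact: subgroup_zexpg.
move/x_inf/eqP; rewrite GRing.mulf_eq0 eqz_nat [c == 0%N]gtn_eqF //=.
by move/eqP.
Qed.
End CyclicQuotient.

(** The quotient by [N] is abelian and finitely generated; the subgroup found there is pulled back
    to [F]. *)
Theorem cyclic_quotient (F : groupType) (N : set F) (nN : normal_subgroup N) :
  derived [set: F] `<=` N -> finitely_generated F ->
  exists K (t : F), let m := exponent (quotient N nN) in
  [/\ subgroup K, N `<=` K, forall f, exists i : int, K (f * (zexpg t i)^-1),
      forall i : int, K (zexpg t i) -> exists q : int, i = (m%:Z * q)%R &
      K (t ^+ m)].
Proof.
move=> dN [S finS gS]; pose Q : groupType := quotient N nN.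
pose p : F -> Q := \pi_(quotient N nN)%qT.
have hp : monoid_morphism p by exact: pi_quotient_morphism.
have piS (a : Q) : exists x, p x = a by exists (repr a); rewrite /p reprK.
have piN x y : N (x^-1 * y) -> p x = p y by move=> Nxy; apply/eqP/coset_eqP.
have cQ (a b : Q) : commute a b.
  have [x <-] := piS a; have [y <-] := piS b.
  rewrite /commute -!(homM hp); apply: piN.
  have -> : (x * y)^-1 * (y * x) = [~ y, x] by rewrite commgEl conjgE invgM !mulgA.
  by apply: dN; exact: derivedT_comm.
have fgQ : finitely_generated Q.
  exists (p @` S); first exact: finite_image.
  apply/seteqP; split=> // a _ B [sB SB]; have [x <-] := piS a.
  have : generated S x by rewrite gS.
  move=> /(_ [set y | B (p y)]); apply; split; last by move=> y Sy; apply: SB; exists y.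
  apply/subgroupP; split; first by rewrite /= (hom1 hp); exact: subgroup1 sB.
  move=> y z By Bz; rewrite /= (homM hp) (homV hp); apply: (subgroupM sB By).
  exact: subgroupV.
have [K [t [sK genK ordK tK]]] : exists K (t : Q),
  [/\ subgroup K, forall x, exists i : int, K (x * (zexpg t i)^-1),
      forall i : int, K (zexpg t i) -> exists q : int, i = ((exponent Q)%:Z * q)%R &
      K (t ^+ exponent Q)].
  have [m0|] := posnP (exponent Q); last exact: cyclic_quotient_finite.
  have [K [t [sK genK ordK]]] := cyclic_quotient_infinite cQ fgQ m0.
  exists K, t; split=> //; rewrite m0 ?expg0; last exact: subgroup1 sK.
  by move=> i /ordK->; exists 0%R; rewrite GRing.mulr0.
have [u pu] := piS t.
exists [set x | K (p x)], u => /=; split=> [|x Nx|f|i|].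
- apply/subgroupP; split; first by rewrite /= (hom1 hp); exact: subgroup1 sK.
  move=> y z Ky Kz; rewrite /= (homM hp) (homV hp); apply: (subgroupM sK Ky).
  exact: subgroupV.
- rewrite /=; have -> : p x = 1 by rewrite -(hom1 hp); apply/esym/piN; rewrite invg1 mul1g.
  exact: subgroup1 sK.
- by have [i Ki] := genK (p f); exists i; rewrite (homM hp) (homV hp) (homZ hp) pu.
- by rewrite (homZ hp) pu => /ordK.
- by rewrite (homX hp) pu.
Qed.

(** * The divisibility theorem *)

Lemma card_dvd_le (T U : Type) (A : set T) (B : set U) :
  B !=set0 -> card_dvd A B -> A #<= B.
Proof.
move=> [b0 Bb0] dvAB; have [->|/set0P[x0 Ax0]] := eqVneq A set0; first exact: card_ge0.
have [a [c [aA inj sur]]] := card_dvd_elim Ax0 dvAB.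
apply: card_le_trans (card_image_le a B); apply: subset_card_le => x Ax.
by have [b [Bb <- _]] := sur x b0 Ax Bb0; exists b.
Qed.

(** The least common multiple has to be exhibited. For [m = 0] it is [|X|], as [X] itself is
    admissible; for [m > 0] it is the positive natural number [L], which divides every infinite
    cardinal. *)
Lemma GCD_dvd_intro (G : groupType) (X : set G) (m : nat) (V : Type) (B : set V) :
  subgroup X ->
  (forall H, subgroup H -> H `<=` X -> card_dvd H `I_m -> card_dvd H B) ->
  GCD_dvd X m B.
Proof.
move=> sX dvB; have subn0 (A : set G) : subgroup A -> A !=set0.
  by move=> sA; exists 1; exact: subgroup1.
have [m0|m0] := posnP m.
  have dvX : card_dvd X `I_m.
    rewrite m0 II0; exact: card_dvd_set0.
  exists G, X; split; last exact: dvB.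
  split; first exact: subn0.
    by move=> H [sH HX _]; exact: card_dvd_subgroup.
  by move=> U E E0 dvE; apply: card_dvd_le => //; apply: dvE; split.
pose P d := `[< exists H : set G, [/\ subgroup H, H `<=` X, card_dvd H `I_m & H #= `I_d] >].
have Im0 : `I_m !=set0 by exists 0%N.
have ordP (H : set G) : subgroup H -> H `<=` X -> card_dvd H `I_m ->
    exists2 d, H #= `I_d & [/\ P d, (0 < d)%N & (d %| m)%N].
  move=> sH HX dvH; have [d Hd] := card_dvd_finite (subn0 _ sH) Im0 dvH (finite_II m).
  have d0 : (0 < d)%N.
    rewrite lt0n; apply/eqP => d0; move: Hd; rewrite d0 II0.
    by rewrite card_eq0 => /eqP H0; have [x] := subn0 _ sH; rewrite H0.
  exists d => //; split=> //; first by apply/asboolP; exists H.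
  by apply/(card_dvd_II m d0); apply: card_dvd_eql dvH => //; exact: subn0.
(* Admissible orders divide [m], so the range [d < m.+1] contains them all. *)
pose L := \big[lcmn/1%N]_(d < m.+1 | P d) d.
have LP e : (forall d, P d -> (d %| e)%N) -> (L %| e)%N.
  by move=> de; apply/dvdn_biglcmP => d /de.
have dL d : P d -> (d %| m)%N -> (d %| L)%N.
  move=> Pd dm; have dm1 : (d < m.+1)%N by rewrite ltnS dvdn_leq.
  exact: (@biglcmn_sup _ (Ordinal dm1)).
have PH d : P d -> exists H : set G, [/\ subgroup H, H `<=` X, card_dvd H `I_m & H #= `I_d].
  by move/asboolP.
have Pdm d : P d -> (d %| m)%N.
  move=> /PH[H [sH HX dvH Hd]]; have [d' Hd' [_ _ d'm]] := ordP H sH HX dvH.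
  by move: Hd; rewrite (card_eql Hd') => /card_eq_II<-.
have dvPE (U : Type) (E : set U) d : P d -> (forall H, subgroup H -> H `<=` X ->
    card_dvd H `I_m -> card_dvd H E) -> card_dvd `I_d E.
  move=> /PH[H [sH HX dvH Hd]] dvE; apply: card_dvd_eql Hd _; first exact: subn0.
  exact: dvE.
have L0 : (0 < L)%N by rewrite (dvdn_gt0 m0) // LP.
have dvLE (U : Type) (E : set U) : (forall H, subgroup H -> H `<=` X ->
    card_dvd H `I_m -> card_dvd H E) -> card_dvd `I_L E.
  move=> dvE; have [[e Ee]|infE] := pselect (finite_set E); last exact: card_dvd_infinite.
  apply: card_dvd_eqr (card_esym Ee) _; apply/card_dvd_II => //; apply: LP => d Pd.
  apply/card_dvd_II; last by apply: card_dvd_eqr Ee _; exact: dvPE.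
  by rewrite (dvdn_gt0 m0) // Pdm.
exists nat, `I_L; split; last exact: dvLE.
split; first by exists 0%N.
- move=> H [sH HX dvH]; have [d Hd [Pd d0 dm]] := ordP H sH HX dvH.
  apply: (card_dvd_eql _ (card_esym Hd)); first by exists 0%N.
  by apply/card_dvd_II => //; exact: dL.
- move=> U E E0 cE; apply: card_dvd_le => //; apply: dvLE => H sH HX dvH.
  by apply: cE; split.
Qed.

Lemma expg_exponent_quotient (F : groupType) (N : set F) (nN : normal_subgroup N) (x : F) :
  N (x ^+ exponent (quotient N nN)).
Proof.
pose p : F -> quotient N nN := \pi_(quotient N nN)%qT.
have hp : monoid_morphism p by exact: pi_quotient_morphism.
have [xm _] := exponentP (quotient N nN).
have : p 1 = p (x ^+ exponent (quotient N nN)) by rewrite (hom1 hp) (homX hp) xm.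
by move/eqP/coset_eqP; rewrite invg1 mul1g.
Qed.

Lemma GCD_dvd_homs (F G : groupType) (N : set F) (nN : normal_subgroup N)
    (X : set G) (Phi : set (F -> G)) :
  derived [set: F] `<=` N -> finitely_generated F -> subgroup X ->
  (forall phi, Phi phi -> monoid_morphism phi) ->
  (forall phi c, Phi phi -> X c -> Phi (conjf phi c)) ->
  (forall (K : set F) (H : set G) phi psi, subgroup K -> N `<=` K -> H `<=` X ->
     Phi phi -> twists K H phi psi -> Phi psi) ->
  GCD_dvd X (exponent (quotient N nN)) Phi.
Proof.
move=> dN fgF sX PhiM PhiJ PhiT; apply: GCD_dvd_intro => // H sH HX dvH.
have [K [t [sK NK genK ordK tK]]] := cyclic_quotient nN dN fgF.
have nK : normal_subgroup K by apply: normal_over_derived => // x /dN/NK.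
apply: (card_dvd_homs nK genK ordK tK sH PhiM) dvH.
- by move=> phi c Pphi /HX; exact: PhiJ.
- by move=> phi psi; exact: PhiT.
Qed.

Lemma subgroup_normaliser (G : groupType) (A : set G) : subgroup (normaliser A).
Proof.
apply/subgroupP; split.
  apply/seteqP; split=> [_ [x Ax <-]|x Ax]; first by rewrite conjg1.
  by exists x; rewrite ?conjg1.
move=> g h Ng Nh; apply/seteqP; split=> [_ [x Ax <-]|x Ax].
  have [y Ay yE] : [set x ^ h | x in A] (x ^ g) by rewrite Nh -Ng; exists x.
  by rewrite conjgM -yE conjgK.
have [y Ay yE] : [set x ^ g | x in A] (x ^ h) by rewrite Ng -Nh; exists x.
by exists y; rewrite ?conjgM ?yE ?conjgK.
Qed.

Lemma sub_normaliser (G : groupType) (A : set G) : subgroup A -> A `<=` normaliser A.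
Proof.
move=> sA g Ag; apply/seteqP; split=> [_ [x Ax <-]|x Ax]; first exact: subgroupJ.
by exists (x ^ g^-1); rewrite ?conjgKV //; apply: (subgroupJ sA) => //; exact: subgroupV.
Qed.

Lemma normaliserJ (G : groupType) (A : set G) g x : normaliser A g -> A x -> A (x ^ g).
Proof. by move=> Ng Ax; rewrite -Ng; exists x. Qed.

Lemma image_conjf (F G : groupType) (W : set F) (phi : F -> G) c :
  conjf phi c @` W = [set x ^ c | x in phi @` W].
Proof. by rewrite image_comp. Qed.

(** * Invariance of the three sets under conjugation and twisting *)

Section Invariance.
Variables (F G : groupType) (W : set F) (A : set G).

Lemma Hom_conjf phi c : normaliser A c -> Hom W A phi -> Hom W A (conjf phi c).
Proof.
move=> Nc [hphi phiA]; split; first exact: hom_conjf.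
by move=> _ [w Ww <-]; apply: normaliserJ => //; apply: phiA; exists w.
Qed.

Lemma Epi_conjf phi c : normaliser A c -> Epi W A phi -> Epi W A (conjf phi c).
Proof.
by move=> Nc [hphi phiA]; split; [exact: hom_conjf | rewrite image_conjf phiA].
Qed.

Lemma Mono_conjf phi c : normaliser A c -> Mono W A phi -> Mono W A (conjf phi c).
Proof.
move=> Nc [hphi phiA phiI].
have [hpsi psiA] := Hom_conjf Nc (conj hphi phiA); split=> //.
by move=> x y Wx Wy /conjg_inj; exact: phiI.
Qed.

Variables (K : set F) (H : set G).

Lemma twists_image phi psi : W `<=` K -> twists K H phi psi -> psi @` W = phi @` W.
Proof. by move=> WK [_ eqK _]; apply: eq_imagel => w /WK; exact: eqK. Qed.

(** Twisting multiplies the values on [W] by elements of [H], hence of [A]. *)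
Lemma Hom_twists phi psi : subgroup A -> H `<=` A -> Hom W A phi -> twists K H phi psi ->
  Hom W A psi.
Proof.
move=> sA HA [hphi phiA] [hpsi eqK Dpsi]; split=> // _ [w Ww <-].
rewrite -(mulgVK (phi w) (psi w)); apply: (subgroupM sA); last by apply: phiA; exists w.
by apply: HA; case: (Dpsi w).
Qed.

(** The factor [psi w * (phi w)^-1] lies in [H], so it is [phi v] with [v] in [W] and in [K]; since
    [psi v = phi v], the element [v^-1 * w] of [W] is sent by [psi] to [phi w]. *)
Lemma Epi_twists phi psi : subgroup A -> subgroup W -> H `<=` A ->
  H `<=` phi @` (W `&` K) -> Epi W A phi -> twists K H phi psi -> Epi W A psi.
Proof.
move=> sA sW HA HphiK [hphi phiA] Tpsi; have [hpsi eqK Dpsi] := Tpsi.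
have phiA' : phi @` W `<=` A by rewrite phiA.
have [_ psiA] := Hom_twists sA HA (conj hphi phiA') Tpsi.
split=> //; apply/seteqP; split=> // a; rewrite -phiA => -[w Ww <-].
have [v [Wv Kv] vE] : (phi @` (W `&` K)) (psi w * (phi w)^-1).
  by apply: HphiK; case: (Dpsi w).
exists (v^-1 * w); first by apply: (subgroupM sW) => //; exact: subgroupV.
by rewrite (homM hpsi) (homV hpsi) eqK // vE invgM invgK mulgVK.
Qed.

(* If psi w = psi w' with w, w' in W, then u = w / w' commutes with W, since psi, hence
   phi, kills the commutators [~ u, v] with v in W; so u lies in K, where psi = phi. *)
Lemma Mono_twists phi psi : subgroup A -> subgroup W -> H `<=` A ->
  derived [set: F] `<=` K -> center W `<=` K -> Mono W A phi -> twists K H phi psi ->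
  Mono W A psi.
Proof.
move=> sA sW HA dK zK [hphi phiA phiI] Tpsi; have [hpsi eqK Dpsi] := Tpsi.
have [_ psiA] := Hom_twists sA HA (conj hphi phiA) Tpsi; split=> //.
have phi1 u : W u -> phi u = 1 -> u = 1.
  move=> Wu pu; apply: phiI; rewrite ?inE ?pu ?(hom1 hphi) //; exact: subgroup1 sW.
move=> w w' /set_mem Ww /set_mem Ww' E; pose u := w * w'^-1.
have Wu : W u by apply: (subgroupM sW) => //; exact: subgroupV.
have psiu : psi u = 1 by rewrite (homM hpsi) (homV hpsi) E mulgV.
suff u1 : u = 1 by apply: (mulIg w'^-1); rewrite mulgV.
apply: (phi1 u) => //; rewrite -eqK //; apply: zK; split=> // v Wv.
apply/commgP/eqP; apply: phi1.
  by rewrite commgEl; apply: (subgroupM sW); [exact: subgroupV | exact: subgroupJ].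
rewrite -eqK; first by rewrite (homR hpsi) psiu comm1g.
by apply: dK; exact: derivedT_comm.
Qed.
End Invariance.

(** * The subgroup [A' A^m] *)

Section DerivedPower.
Variables (G : groupType) (A : set G) (m : nat).
Hypothesis sA : subgroup A.

Lemma sub_derived_power (B : set G) : subgroup B ->
  (forall x y, A x -> A y -> B [~ x, y]) -> (forall x, A x -> B (x ^+ m)) ->
  mulset (derived A) (power_subgroup A m) `<=` B.
Proof.
move=> sB Bc Bm _ [x dx [y py <-]]; apply: (subgroupM sB).
  by apply: dx; split=> // _ [a Aa [b Ab <-]]; exact: Bc.
by apply: py; split=> // _ [a Aa <-]; exact: Bm.
Qed.

Lemma subgroupR (B : set G) x y : subgroup B -> B x -> B y -> B [~ x, y].
Proof.
move=> sB Bx By; rewrite commgEl; apply: (subgroupM sB); first exact: subgroupV.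
exact: subgroupJ.
Qed.

Lemma derived_power_sub : mulset (derived A) (power_subgroup A m) `<=` A.
Proof.
by apply: sub_derived_power => // [x y Ax Ay|x Ax]; [exact: subgroupR | exact: subgroup_expg].
Qed.

(** [A] normalises its derived subgroup and contains the other factor. *)
Lemma subgroup_derived_power : subgroup (mulset (derived A) (power_subgroup A m)).
Proof.
have sD : subgroup (derived A) by exact: subgroup_generated.
have sP : subgroup (power_subgroup A m) by exact: subgroup_generated.
have PA : power_subgroup A m `<=` A.
  by move=> y; apply; split=> // _ [a Aa <-]; exact: subgroup_expg.
have DJ x a : derived A x -> A a -> derived A (x ^ a).
  move=> Dx Aa; apply: (Dx [set y | derived A (y ^ a)]); split.
    apply/subgroupP; split; first by rewrite /= conj1g; exact: subgroup1 sD.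
    move=> y z Dy Dz; rewrite /= conjMg conjVg; apply: (subgroupM sD Dy).
    exact: (subgroupV sD).
  move=> _ [y Ay [z Az <-]]; rewrite /= conjRg; apply: sub_gen_smallest.
  by exists (y ^ a); [exact: subgroupJ | exists (z ^ a) => //; exact: subgroupJ].
apply/subgroupP; split.
  by exists 1; [exact: subgroup1 sD | exists 1; [exact: subgroup1 sP | rewrite mulg1]].
move=> _ _ [d Dd [p Pp <-]] [e De [q Pq <-]].
have Ppq : power_subgroup A m (p * q^-1) by apply: (subgroupM sP) => //; exact: (subgroupV sP).
exists (d * (e^-1 ^ (p * q^-1)^-1)).
  apply: (subgroupM sD Dd); apply: DJ; first exact: (subgroupV sD).
  by apply: (subgroupV sA); exact: PA.
exists (p * q^-1) => //.
by rewrite conjgE !invgM !invgK !mulgA !mulgVK mulgK.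
Qed.
End DerivedPower.

Theorem mainTheorem1 (G F : groupType) (A : set G) (W : set F)
    (sA : subgroup A) (sW : subgroup W) (fgF : finitely_generated F) :
  [/\ (* a *)
      let m := exponent (quotient (mulset (derived [set: F]) W)
                                  (normal_derivedM sW)) in
      [/\ GCD_dvd (normaliser A) m (Hom W A),
          GCD_dvd (normaliser A) m (Epi W A) &
          GCD_dvd (normaliser A) m (Mono W A)],
      (* b *)
      let m := exponent (quotient (derived [set: F]) (normal_derived F)) in
      GCD_dvd A m (Hom W A),
      (* c *)
      let m := exponent (quotient (derived [set: F]) (normal_derived F)) in
      GCD_dvd (mulset (derived A) (power_subgroup A m)) m (Epi W A) &
      (* d *)
      let m := exponent (quotient (mulset (derived [set: F]) (center W))
                                  (normal_derivedM (subgroup_center sW))) in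
      GCD_dvd A m (Mono W A)].
Proof.
have dM (B : set F) : subgroup B -> derived [set: F] `<=` mulset (derived [set: F]) B.
  by move=> sB x dx; exists x => //; exists 1; [exact: subgroup1 sB | rewrite mulg1].
have sM (B : set F) : B `<=` mulset (derived [set: F]) B.
  move=> x Bx; exists 1; last by exists x; rewrite ?mul1g.
  exact: subgroup1 (subgroup_generated _).
have AN := sub_normaliser sA.
split=> /=.
(* For all three sets [W] lies in [K], so twisting does not change the restriction to [W]. *)
- split; apply: GCD_dvd_homs => //; try exact: dM; try exact: subgroup_normaliser.
  + by move=> phi [].
  + by move=> phi c Pphi Nc; exact: Hom_conjf.
  + move=> K H phi psi sK NK _ [hphi phiA] Tpsi; have [hpsi _ _] := Tpsi.
    by split=> //; rewrite (twists_image _ Tpsi) // => x /sM/NK.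
  + by move=> phi [].
  + by move=> phi c Pphi Nc; exact: Epi_conjf.
  + move=> K H phi psi sK NK _ [hphi phiA] Tpsi; have [hpsi _ _] := Tpsi.
    by split=> //; rewrite (twists_image _ Tpsi) // => x /sM/NK.
  + by move=> phi [].
  + by move=> phi c Pphi Nc; exact: Mono_conjf.
  + move=> K H phi psi sK NK _ [hphi phiA phiI] Tpsi; have [hpsi eqK _] := Tpsi.
    have WK : W `<=` K by move=> x /sM/NK.
    split=> //; first by rewrite (twists_image _ Tpsi).
    move=> x y Wx Wy; rewrite !eqK; [exact: phiI | |]; apply: WK; exact: set_mem.
- apply: GCD_dvd_homs => //.
  + by move=> phi [].
  + by move=> phi c Pphi /AN Nc; exact: Hom_conjf.
  + by move=> K H phi psi sK NK HA Pphi Tpsi; exact: Hom_twists HA Pphi Tpsi.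
- have XA := @derived_power_sub G A (exponent (quotient (derived [set: F]) (normal_derived F))) sA.
  apply: GCD_dvd_homs => //.
  + exact: subgroup_derived_power.
  + by move=> phi [].
  + by move=> phi c Pphi /XA/AN Nc; exact: Epi_conjf.
  + move=> K H phi psi sK NK HX Pphi; have [hphi phiA] := Pphi.
    apply: Epi_twists => //; first exact: subset_trans XA.
    (* Since [A = phi W], commutators and [m]-th powers in [A] come from those in [W], which lie in
       [F'] and hence in [K]. *)
    apply: subset_trans HX _; apply: sub_derived_power.
    * apply/subgroupP; split.
        by exists 1; [split; [exact: subgroup1 sW | exact: subgroup1 sK] | exact: hom1].
      move=> _ _ [x [Wx Kx] <-] [y [Wy Ky] <-].
      exists (x * y^-1); last by rewrite (homM hphi) (homV hphi).
      by split; [apply: (subgroupM sW Wx) | apply: (subgroupM sK Kx)]; [exact: (subgroupV sW) | exact: (subgroupV sK)].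
    * rewrite -phiA => _ _ [x Wx <-] [y Wy <-]; exists [~ x, y]; last exact: homR.
      by split; [exact: subgroupR | apply: NK; exact: derivedT_comm].
    * rewrite -phiA => _ [x Wx <-]; exists (x ^+ exponent (quotient (derived [set: F]) (normal_derived F))).
        by split; [exact: subgroup_expg | apply: NK; exact: expg_exponent_quotient].
      exact: homX.
- apply: GCD_dvd_homs => //; first by apply: dM; exact: subgroup_center.
  + by move=> phi [].
  + by move=> phi c Pphi /AN Nc; exact: Mono_conjf.
  + move=> K H phi psi sK NK HA Pphi; apply: Mono_twists => //.
      by move=> x /(dM _ (subgroup_center sW))/NK.
    by move=> x /sM/NK.
Qed.
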